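(* Let $K\subset\mathbb{R}^2$ be the Lévy Dragon and let $\partial K$ be its topological boundary. For $k\ge 1$ let $B_k$ be the set of sequences $I_k=(i_1,\dots,i_k)\in\{1,2\}^k$ such that $f_{I_k}(T_0)\cap\partial F^k(T_0)\neq\emptyset$, and let $\beta=\lim_{k\to\infty}|B_k|^{1/k}$. Then $$\dim_H \partial K=\frac{\ln \beta}{\ln\sqrt2}.$$ Moreover, $0<\mathcal{H}^{\alpha}(\partial K)<+\infty$, where $\alpha=\frac{\ln\beta}{\ln\sqrt2}$ and $\mathcal{H}^{\alpha}$ denotes $\alpha$-dimensional Hausdorff measure.
   Context: Let $f_1(x,y)=\left(\frac{x-y}{2},\frac{x+y}{2}\right)$ and $f_2(x,y)=\left(\frac{x+y+1}{2},\frac{y-x+1}{2}\right)$, contracting similitudes of $\mathbb{R}^2$ with ratio $1/\sqrt2$. For a nonempty compact set $X\subset\mathbb{R}^2$ put $F(X)=f_1(X)\cup f_2(X)$, and let $F^k$ be the $k$-fold iterate of $F$. The Lévy Dragon $K$ is the unique nonempty compact set with $F(K)=K$. For $I_k=(i_1,\dots,i_k)\in\{1,2\}^k$ write $f_{I_k}=f_{i_1}f_{i_2}\cdots f_{i_k}$ (composition). $T_0$ is the closed (filled) triangle with vertices $(0,0)$, $(1/2,1/2)$, $(1,0)$. Thus $F^k(T_0)=\bigcup_{I_k\in\{1,2\}^k}f_{I_k}(T_0)$. $\partial$ denotes topological boundary in $\mathbb{R}^2$, $\dim_H$ Hausdorff dimension, and $|\cdot|$ cardinality. *)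

(* Defs.v *)
From mathcomp Require Import all_boot all_order all_algebra.
From mathcomp Require Import all_classical all_reals all_analysis.

Set Implicit Arguments.
Unset Strict Implicit.
Unset Printing Implicit Defensive.

Import Order.TTheory GRing.Theory Num.Theory.
Import numFieldNormedType.Exports.

Local Open Scope classical_set_scope.
Local Open Scope ring_scope.

Definition boundary {T : topologicalType} (A : set T) : set T :=
  closure A `\` interior A.

Section Hausdorff.
Context {R : realType}.
Local Open Scope ereal_scope.

(* The norm that the library puts on a product is the max norm, so the
   Euclidean distance is defined explicitly; both induce the same topology. *)
Definition edist (p q : R * R) : R :=
  Num.sqrt ((p.1 - q.1) ^+ 2 + (p.2 - q.2) ^+ 2)%R.

Definition diam (U : set (R * R)) : \bar R :=
  ereal_sup [set (edist p q)%:E | p in U & q in U].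

(* The empty set is treated apart: it contributes 0 for every s, including
   s = 0, while a point contributes 0 `^ 0 = 1 (counting measure for s = 0). *)
Definition diam_pow (s : R) (U : set (R * R)) : \bar R :=
  if U == set0 then 0 else diam U `^ s.

Definition delta_cover (delta : R) (E : set (R * R)) : set ((set (R * R))^nat) :=
  [set U | E `<=` \bigcup_i U i /\ forall i, diam (U i) <= delta%:E].

Definition hausdorff_content (s delta : R) (E : set (R * R)) : \bar R :=
  ereal_inf [set \sum_(0 <= i <oo) diam_pow s (U i) | U in delta_cover delta E].

(* No normalizing constant *)
Definition hausdorff_measure (s : R) (E : set (R * R)) : \bar R :=
  ereal_sup [set hausdorff_content s delta E | delta in [set d : R | (0 < d)%R]].

Definition hausdorff_dim (E : set (R * R)) : \bar R :=
  ereal_inf [set s%:E | s in [set s : R | (0 <= s)%R /\ hausdorff_measure s E = 0]].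

End Hausdorff.

Section LevyDragon.
Context {R : realType}.
Implicit Types (p : R * R) (X : set (R * R)).

Definition f1 p : R * R := ((p.1 - p.2) / 2, (p.1 + p.2) / 2).
Definition f2 p : R * R := ((p.1 + p.2 + 1) / 2, (p.2 - p.1 + 1) / 2).

(* The alphabet {1, 2} is encoded as 'I_2 = {0, 1}. *)
Definition f (i : 'I_2) : R * R -> R * R := if i == ord0 then f1 else f2.

Definition F X : set (R * R) := f1 @` X `|` f2 @` X.

Definition is_levy_dragon X : Prop := [/\ X !=set0, compact X & F X = X].

(* f_I = f_{i_1} \o ... \o f_{i_k}; in particular f_{i_k} is applied first. *)
Definition f_word (k : nat) (I : k.-tuple 'I_2) : R * R -> R * R :=
  foldr (fun i g => f i \o g) id I.

(* Convex combinations of the vertices (0, 0), (1/2, 1/2) and (1, 0) *)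
Definition T0 : set (R * R) :=
  [set p | exists a b c : R, [/\ 0 <= a, 0 <= b, 0 <= c, a + b + c = 1 &
    p = a *: ((0, 0) : R * R) + b *: ((1 / 2, 1 / 2) : R * R)
        + c *: ((1, 0) : R * R)]].

Definition B (k : nat) : {set k.-tuple 'I_2} :=
  [set I : k.-tuple 'I_2 |
    `[< (f_word I @` T0) `&` boundary (iter k F T0) !=set0 >]]%SET.

End LevyDragon.
Arguments B R k : clear implicits.

(* Main.v *)
(* The triangles obtained from T0 by the maps z |-> uz + p, with u a power of i
   and p a Gaussian integer, tile the plane, and this is compatible with
   subdivision by f_1 and f_2. Hence f_I(T0) meets the boundary of F^k(T0) iff
   it touches a triangle s f_J(T0) with s <> 1 and J of length k, and the
   boundary of K is the union of the intersections of K with its other copies.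
   The position of s f_J relative to f_I takes finitely many values and
   evolves along a finite graph when the words are extended. Up to bounded
   factors, the boundary words are those carried by a single strongly
   connected component of 28 positions. Irreducibility of this component makes
   the number A_n of these words both submultiplicative and, up to a constant,
   supermultiplicative, so that A_n is comparable with beta^n. Covering the
   boundary of K by the corresponding cells bounds its Hausdorff measure from
   above; from below, a finite cover by sets of diameters close to sqrt 2^-k_i
   meets a bounded number of cells of length k_i for each i, and counting the
   extensions of these words up to a large length bounds the sum of the
   beta^-k_i from below. *)

Require Import Defs.
From mathcomp Require Import all_boot all_order all_algebra.
From mathcomp Require Import all_classical all_reals all_analysis.
From mathcomp Require Import zify ring lra.
Import Order.TTheory GRing.Theory Num.Theory.
Import numFieldNormedType.Exports.
Local Open Scope classical_set_scope.
Local Open Scope ring_scope.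

(* Not the distance to a set of MathComp-Analysis, which has the same name. *)
Local Notation edist := Defs.edist.

Set Implicit Arguments.
Unset Strict Implicit.
Unset Printing Implicit Defensive.

(** * Relative positions of cells *)

(* [(a, b, c, d)] stands for the map z |-> (a + bi) z + (c + di) of the complex
   plane. *)
Definition iso : Type := (int * int * int * int)%type.

Definition iso1 : iso := (1, 0, 0, 0).

Definition iso_mul (s t : iso) : iso :=
  let: (a, b, c, d) := s in let: (a', b', c', d') := t in
  (a * a' - b * b', a * b' + b * a', a * c' - b * d' + c, a * d' + b * c' + d).

Definition units : seq (int * int) := [:: (1, 0); (0, 1); (-1, 0); (0, -1)].

Definition unit_iso (s : iso) : bool := s.1.1 \in units.

(* [step i j s] is the map t with s \o f_j = f_i \o t. *)
Definition step (i j : 'I_2) (s : iso) : iso :=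
  let: (a, b, c, d) := s in
  if i == ord0 then
    if j == ord0 then (a, b, c + d, d - c) else (b, - a, a + c + d, b + d - c)
  else
    if j == ord0 then (- b, a, c - d, c + d - 1)
    else (a, b, c - d - b, a + c + d - 1).

Arguments step : simpl never.

(** For I and J of equal length this is f_I^-1 s f_J, the position of the cell J of the s-copy
    relative to the cell I; [act_f_seq] makes this precise. *)
Fixpoint run (s : iso) (I J : seq 'I_2) : iso :=
  if I is i :: I' then if J is j :: J' then run (step i j s) I' J' else s else s.

Variant letter_spec : 'I_2 -> Prop :=
| Letter0 : letter_spec ord0
| Letter1 : letter_spec ord_max.

Lemma letterP (i : 'I_2) : letter_spec i.
Proof.
case: i => [[|[|//]]] h.
- by rewrite (_ : Ordinal h = ord0); [constructor | exact/val_inj].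
- by rewrite (_ : Ordinal h = ord_max); [constructor | exact/val_inj].
Qed.

Variant unit_spec : int -> int -> Prop :=
| Unit0 : unit_spec 1 0
| Unit1 : unit_spec 0 1
| Unit2 : unit_spec (-1) 0
| Unit3 : unit_spec 0 (-1).

Lemma unitP (a b c d : int) : unit_iso (a, b, c, d) -> unit_spec a b.
Proof.
by rewrite /unit_iso !inE => /or4P[] /eqP[-> ->]; constructor.
Qed.

Lemma unit_iso1 : unit_iso iso1. Proof. by []. Qed.

Lemma unit_iso_inv (s : iso) : unit_iso s ->
  exists2 t, unit_iso t & iso_mul t s = iso1.
Proof.
case: s => [[[a b] c] d] us.
(* The inverse of z |-> uz + p is z |-> vz - vp, where v is the conjugate of the unit u. *)
exists (a, - b, - (a * c + b * d), b * c - a * d); first by case/unitP: us.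
by case/unitP: us; congr (_, _, _, _); lia.
Qed.

Lemma unit_iso_step (i j : 'I_2) (s : iso) : unit_iso s -> unit_iso (step i j s).
Proof.
by case: s => [[[a b] c] d] /unitP; case: (letterP i); case: (letterP j) => -[].
Qed.

Lemma iso_mul1g (s : iso) : iso_mul iso1 s = s.
Proof. by case: s => [[[a b] c] d]; congr (_, _, _, _); lia. Qed.

Lemma run_unit (s : iso) (I J : seq 'I_2) : unit_iso s -> unit_iso (run s I J).
Proof.
by elim: I s J => [|i I IH] s [|j J] //= us; apply/IH/unit_iso_step.
Qed.

Lemma run_cat (s : iso) (I I' J J' : seq 'I_2) : size I = size J ->
  run s (I ++ I') (J ++ J') = run (run s I J) I' J'.
Proof. by elim: I s J => [|i I IH] s [|j J] //= -[] /IH ->. Qed.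

Lemma step_id (i : 'I_2) : step i i iso1 = iso1.
Proof. by case: (letterP i). Qed.

Lemma run_id (I : seq 'I_2) : run iso1 I I = iso1.
Proof. by elim: I => //= i I; rewrite step_id. Qed.

(* A parity argument: the two possible parents of a unit edge lie in different
   classes of Z[i] modulo 1 + i. *)
Lemma step_inj (i j j' : 'I_2) (s s' : iso) : unit_iso s -> unit_iso s' ->
  step i j s = step i j' s' -> s = s' /\ j = j'.
Proof.
case: s s' => [[[a b] c] d] [[[a' b'] c'] d'] /unitP hs /unitP hs' h.
suff: (a, b, c, d) = (a', b', c', d') /\ (j == ord0) = (j' == ord0).
  by case=> ->; case: (letterP j); case: (letterP j').
move: h; rewrite /step.
by case: (i == ord0); case: (j == ord0); case: (j' == ord0) => /= -[h1 h2 h3 h4];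
  case: hs h1 h2 h3 h4; case: hs' => h1 h2 h3 h4;
  (split; [congr (_, _, _, _); lia | by [] || lia]).
Qed.

(** [step_inj] recovers sources and letters backwards from the end of the path. Hence a triangle of
    the tiling is a cell of only one copy, with only one address. *)
Lemma run_inj (s s' : iso) (I J J' : seq 'I_2) : unit_iso s -> unit_iso s' ->
  size I = size J -> size I = size J' ->
  run s I J = run s' I J' -> s = s' /\ J = J'.
Proof.
elim: I s s' J J' => [|i I IH] s s' [|j J] [|j' J'] //= us us' [hJ] [hJ'] h.
have [h1 ->] := IH _ _ _ _ (unit_iso_step i j us) (unit_iso_step i j' us') hJ hJ' h.
by have [-> ->] := step_inj us us' h1.
Qed.

Lemma run_neq1 (s : iso) (I J : seq 'I_2) : unit_iso s -> size I = size J ->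
  s != iso1 -> run s I J != iso1.
Proof.
move=> us h; apply: contraNneq => h1.
by have [-> _] := run_inj us unit_iso1 h erefl (etrans h1 (esym (run_id I))).
Qed.

Lemma step_surj (i : 'I_2) (t : iso) : unit_iso t ->
  exists2 s, unit_iso s & exists j, step i j s = t.
Proof.
case: t => [[[a b] c] d] /unitP ht.
(* Inverting [step] halves the translation. As b - a is odd, the parity of c + d decides which
   letter has an integral preimage: j = i if it is even, the other letter if it is odd. *)
pose k := ((c + d) %/ 2)%Z; pose l := ((c + d + b - a + 1) %/ 2)%Z.
have hl : c + d = k + k -> c + d + b - a + 1 = l + l by case: ht @l => l; lia.
have hl' : c + d = k + k + 1 -> c + d + b - a = l + l by case: ht @l {hl} => l; lia.
have [hk|hk] : c + d = k + k \/ c + d = k + k + 1 by lia.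
- have {}hl := hl hk; case: (letterP i).
  + exists (a, b, c - k, k); first by case: ht.
    by exists ord0; congr (_, _, _, _); lia.
  + exists (a, b, l, l - c - b); first by case: ht.
    by exists ord_max; congr (_, _, _, _); lia.
- have {}hl := hl' hk; case: (letterP i).
  + exists (- b, a, c + b - l, l); first by case: ht.
    by exists ord_max; congr (_, _, _, _); lia.
  + exists (b, - a, k + 1, d - k); first by case: ht.
    by exists ord0; congr (_, _, _, _); lia.
Qed.

Lemma run_surj (I : seq 'I_2) (t : iso) : unit_iso t ->
  exists s J, [/\ unit_iso s, size I = size J & run s I J = t].
Proof.
elim: I t => [|i I IH] t ut; first by exists t, [::].
have [s [J [us sJ <-]]] := IH t ut.
have [s' us' [j <-]] := step_surj i us.
by exists s', (j :: J); rewrite /= sJ.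
Qed.

(** * The neighbor graph *)

(* With an edge from [s] to each [step i j s], the positions s <> 1 for which the
   dragon meets its image by s form a graph whose strongly connected component of
   largest growth rate (about 1.955) is [graph]. *)
Definition graph : seq iso :=
  [:: (-1, 0, 0, 1); (-1, 0, 1, 0); (-1, 0, 1, 1); (-1, 0, 2, 1);
      (0, -1, -1, 0); (0, -1, -1, 1); (0, -1, 0, 0); (0, -1, 0, 1);
      (0, -1, 0, 2); (0, -1, 1, 0); (0, -1, 1, 1); (0, -1, 1, 2);
      (0, 1, 0, -1); (0, 1, 0, 0); (0, 1, 0, 1); (0, 1, 1, -1);
      (0, 1, 1, 0); (0, 1, 1, 1); (0, 1, 2, -1); (0, 1, 2, 0);
      (1, 0, -1, -1); (1, 0, -1, 0); (1, 0, -1, 1); (1, 0, 0, -1);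
      (1, 0, 0, 1); (1, 0, 1, -1); (1, 0, 1, 0); (1, 0, 1, 1)].

(* [hub] rotates T0 about its vertex 0, which belongs to the dragon. *)
Definition hub : iso := (0, 1, 0, 0).

(* The least n such that any two vertices of [graph] are joined by a path of
   length exactly n. *)
Definition mixing : nat := 9.

Definition letters : seq 'I_2 := [:: ord0; ord_max].

Definition inbox (r : nat) (s : iso) : bool :=
  let: (_, _, c, d) := s in [&& unit_iso s, (`|c| <= r)%N & (`|d| <= r)%N].

Definition ints (r : nat) : seq int := [seq k%:Z - r%:Z | k <- iota 0 r.*2.+1].

Definition box (r : nat) : seq iso :=
  [seq (u.1, u.2, p.1, p.2) | u <- units, p <- [seq (c, d) | c <- ints r, d <- ints r]].

Lemma mem_letters (i : 'I_2) : i \in letters.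
Proof. by case: (letterP i). Qed.

Lemma mem_ints (r : nat) (c : int) : (`|c| <= r)%N -> c \in ints r.
Proof.
move=> hc; apply/mapP; exists (absz (c + r%:Z)); last by lia.
by rewrite mem_iota; lia.
Qed.

Lemma mem_box (r : nat) (s : iso) : inbox r s -> s \in box r.
Proof.
case: s => [[[a b] c] d] /and3P[us /mem_ints hc /mem_ints hd].
have -> : (a, b, c, d) = ((a, b).1, (a, b).2, (c, d).1, (c, d).2) by [].
apply: (@allpairs_f _ _ _ (fun u p => (u.1, u.2, p.1, p.2))) => //.
exact: (@allpairs_f _ _ _ (fun c d => (c, d))).
Qed.

Lemma unit_graph (s : iso) : s \in graph -> unit_iso s.
Proof.
have /allP h : all unit_iso graph by vm_compute.
exact: h.
Qed.

Lemma graph_neq1 (s : iso) : s \in graph -> s != iso1.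
Proof.
have /allP h : all (predC1 iso1) graph by vm_compute.
exact: h.
Qed.

(** Inverting a step divides the translation by sqrt 2 up to a bounded shift. The predecessors of
    [graph] thus lie in a finite box, and [step_graph] becomes a finite check. *)
Lemma step_graph_box (i j : 'I_2) (s : iso) :
  unit_iso s -> step i j s \in graph -> s \in box 3.
Proof.
move=> us hst; apply: mem_box.
have /allP /(_ _ hst) : all (fun t : iso => let: (_, _, c, d) := t in
    [&& -2 <= c, c <= 2, -2 <= d & d <= 2]) graph by vm_compute.
case: s us {hst} => [[[a b] c] d] us; rewrite /inbox us /step /=.
by case/unitP: us; case: (i == ord0); case: (j == ord0) => /and4P[*]; lia.
Qed.

Lemma step_graph (i j : 'I_2) (s : iso) : unit_iso s -> s != iso1 ->
  step i j s \in graph -> s \in graph.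
Proof.
move=> us s1 hst; have sbox := step_graph_box us hst.
have /allP /(_ _ sbox) : all (fun s => (s != iso1) ==>
    all (fun i => all (fun j => (step i j s \in graph) ==> (s \in graph)) letters) letters) (box 3).
  by vm_compute.
by rewrite s1 => /allP /(_ i (mem_letters i)) /allP /(_ j (mem_letters j)); rewrite hst.
Qed.

Lemma run_graph (s : iso) (I J : seq 'I_2) : unit_iso s -> s != iso1 ->
  size I = size J -> run s I J \in graph -> s \in graph.
Proof.
elim: I s J => [|i I IH] s [|j J] //= us s1 [hIJ] h.
have us' := unit_iso_step i j us.
have s1' : step i j s != iso1.
  by apply: (@run_neq1 s [:: i] [:: j]).
exact: step_graph us s1 (IH _ _ us' s1' hIJ h).
Qed.

Definition children (s : iso) : seq iso :=
  undup [seq t <- [seq step i j s | i <- letters, j <- letters] | t \in graph].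

(** Removing duplicates at each level keeps the lists no longer than [graph], although the number of
    paths grows exponentially. *)
Definition descendants (n : nat) (s : iso) : seq iso :=
  iter n (fun L => undup (flatten [seq children t | t <- L])) [:: s].

Lemma descendantsP (n : nat) (s t : iso) : t \in descendants n s ->
  exists I J, [/\ size I = n, size J = n & run s I J = t].
Proof.
elim: n t => [|n IH] t; first by rewrite inE => /eqP ->; exists [::], [::].
rewrite /= mem_undup => /flatten_mapP[t' /IH[I [J [sI sJ <-]]]].
rewrite mem_undup mem_filter => /andP[_ /allpairsP[[i j] [_ _ ->]]].
exists (rcons I i), (rcons J j); split; rewrite ?size_rcons ?sI ?sJ //.
by rewrite -!cats1 run_cat ?sI.
Qed.

Lemma graph_mixing (s t : iso) : s \in graph -> t \in graph ->
  exists I J, [/\ size I = mixing, size J = mixing & run s I J = t].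
Proof.
move=> sG tG; apply: descendantsP.
have /allP /(_ s sG) : all (fun s =>
    let L := descendants mixing s in all (fun t => t \in L) graph) graph.
  by vm_compute.
by move=> /allP /(_ t tG).
Qed.

(** Only the ends of the path are required to be in [graph]: the vertices in between then are too,
    by [run_graph]. The address J of the neighbor is forgotten. *)
Definition graph_word (I : seq 'I_2) : Prop :=
  exists s J, [/\ s \in graph, size I = size J & run s I J \in graph].

Lemma graph_word_of_run (s : iso) (I J : seq 'I_2) : unit_iso s -> s != iso1 ->
  size I = size J -> run s I J \in graph -> graph_word I.
Proof.
move=> us s1 hIJ h; exists s, J; split => //.
exact: (run_graph us s1 hIJ h).
Qed.

(** The path is cut after I; the vertex reached there is in [graph] because it is not [iso1] and
    leads to [graph]. *)
Lemma graph_word_cat (I J : seq 'I_2) : graph_word (I ++ J) -> graph_word I /\ graph_word J.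
Proof.
move=> [s [K [sG hK h]]].
pose K1 := take (size I) K; pose K2 := drop (size I) K.
have hK1 : size I = size K1.
  by rewrite size_takel // -hK size_cat leq_addr.
have hK2 : size J = size K2 by rewrite size_drop -hK size_cat addKn.
move: h; rewrite -(cat_take_drop (size I) K) run_cat // => h.
have us := unit_graph sG; have s1 := graph_neq1 sG.
have us' : unit_iso (run s I K1) by exact: run_unit.
have s1' : run s I K1 != iso1 by exact: run_neq1.
split; last exact: (graph_word_of_run us' s1' hK2 h).
by exists s, K1; split; rewrite ?hK1 ?(run_graph us' s1' hK2 h).
Qed.

Lemma graph_word_mixing (I J : seq 'I_2) : graph_word I -> graph_word J ->
  exists2 P, size P = mixing & graph_word (I ++ P ++ J).
Proof.
move=> [s [I' [sG hI h]]] [t [J' [tG hJ h']]].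
have [P [P' [sP sP' hP]]] := graph_mixing h tG.
exists P => //; exists s, (I' ++ P' ++ J'); split => //.
  by rewrite !size_cat hI hJ sP sP'.
by rewrite !run_cat ?sP ?sP' // hP.
Qed.

(** At [hub] the two cells share the image of the vertex 0. This gives a common point of the dragon
    and another copy in the cell I. *)
Lemma graph_word_hub (I : seq 'I_2) : graph_word I ->
  exists s J P, [/\ unit_iso s, s != iso1, size P = mixing,
    size (I ++ P) = size J & run s (I ++ P) J = hub].
Proof.
move=> [s [I' [sG hI h]]].
have hubG : hub \in graph by [].
have [P [P' [sP sP' hP]]] := graph_mixing h hubG.
exists s, (I' ++ P'), P; split => //.
- exact: unit_graph.
- exact: graph_neq1.
- by rewrite !size_cat hI sP sP'.
- by rewrite run_cat.
Qed.

Lemma graph_word_letter (i : 'I_2) : graph_word [:: i].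
Proof.
case: (letterP i); first by exists (-1, 0, 1, 1), [:: ord_max].
by exists (-1, 0, 1, 1), [:: ord0].
Qed.

Lemma graph_word_nseq (n : nat) : exists2 I, size I = n & graph_word I.
Proof.
elim: n => [|n [I sI gI]]; first by exists [::] => //; exists hub, [::].
have [P sP] := graph_word_mixing gI (graph_word_letter ord0).
have -> : I ++ P ++ [:: ord0] = take n.+1 (I ++ P ++ [:: ord0]) ++
  drop n.+1 (I ++ P ++ [:: ord0]) by rewrite cat_take_drop.
move=> /graph_word_cat[h _]; exists (take n.+1 (I ++ P ++ [:: ord0])) => //.
by rewrite size_takel // !size_cat sI sP /=; lia.
Qed.

(* Found by breadth-first search: along the cell with this address all the
   neighbors coming from other copies of the dragon disappear. *)
Definition interior_word : seq 'I_2 :=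
  [seq if b then ord_max else ord0 | b <- [:: false; true; false; true; true;
    true; false; true; false; true; false; true; true; false; true; true; false;
    true; true; true; false]].

(** Positions outside box 3 are dropped because there the dragon does not meet its image, by
    [dragon_near_inbox]. *)
Definition survivors (i : 'I_2) (L : seq iso) : seq iso :=
  undup [seq t <- [seq step i j s | s <- L, j <- letters] | inbox 3 t].

Lemma foldl_survivors (s : iso) (L : seq iso) (I J : seq 'I_2) : s \in L ->
  size I = size J -> (forall k, inbox 3 (run s (take k I) (take k J))) ->
  run s I J \in foldl (fun L i => survivors i L) L I.
Proof.
elim: I s L J => [|i I IH] s L [|j J] //= sL [hIJ] hk.
apply: IH => // [|k]; last exact: (hk k.+1).
rewrite mem_undup mem_filter (_ : inbox 3 _); last by have := hk 1; rewrite /= !take0.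
by apply: allpairs_f => //; exact: mem_letters.
Qed.

(** The search starts from all positions of box 3 except [iso1], and no position survives the whole
    word. *)
Lemma interior_wordP (s : iso) (J : seq 'I_2) :
  s != iso1 -> size interior_word = size J ->
  ~ forall k, inbox 3 (run s (take k interior_word) (take k J)).
Proof.
move=> s1 hJ hk.
have sL : s \in [seq s <- box 3 | s != iso1].
  by rewrite mem_filter s1 mem_box //; have := hk 0; rewrite !take0.
have := foldl_survivors sL hJ hk.
suff -> : foldl (fun L i => survivors i L) [seq s <- box 3 | s != iso1] interior_word = [::] by [].
by apply/nilP; vm_compute.
Qed.

(* The three triangles sharing an edge with T0. *)
Definition generators : seq iso := [:: (-1, 0, 1, 0); (0, -1, 0, 1); (0, 1, 1, 0)].

(** One round of breadth-first search: multiplying on the right by a generator passes to a triangle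
    with a common edge. *)
Definition expand (L : seq iso) : seq iso :=
  undup (L ++ [seq t <- [seq iso_mul s g | s <- L, g <- generators] | inbox 4 t]).

Lemma generators_graph (g : iso) : g \in generators -> g \in graph.
Proof.
have /allP h : all (mem graph) generators by vm_compute.
exact: h.
Qed.

Lemma iter_expand_prop (Q : iso -> Prop) (n : nat) : Q iso1 ->
  (forall t g, inbox 4 t -> g \in generators -> Q t -> Q (iso_mul t g)) ->
  {in iter n expand [:: iso1], forall s, inbox 4 s /\ Q s}.
Proof.
move=> Q1 Qg; elim: n => [|n IH] s /=; first by rewrite inE => /eqP ->.
rewrite mem_undup mem_cat mem_filter => /orP[/IH //|/andP[hs /allpairsP[[t g] /= [tL gG e]]]].
by split => //; rewrite e; have [? ?] := IH _ tL; exact: Qg.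
Qed.

Lemma all_subset (L L' : seq iso) : all (mem L') L -> {subset L <= L'}.
Proof. by move/allP. Qed.

Lemma box_expand : {subset box 3 <= iter 16 expand [:: iso1]}.
Proof.
apply: all_subset.
by vm_compute.
Qed.

(* A chain of triangles with common edges leads from T0 to [s]. *)
Lemma crossing (Q : iso -> Prop) (s : iso) : Q iso1 -> inbox 3 s -> ~ Q s ->
  exists t g, [/\ inbox 4 t, g \in generators, Q t & ~ Q (iso_mul t g)].
Proof.
move=> Q1 hs nQs; apply: contrapT => hno; apply: nQs.
have Qg t g : inbox 4 t -> g \in generators -> Q t -> Q (iso_mul t g).
  move=> ht gG Qt; apply: contrapT => nQ; apply: hno.
  by exists t, g.
by have [] := iter_expand_prop Q1 Qg (box_expand (mem_box hs)).
Qed.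

(** In (f_i^-1 s f_j) (f_j^-1 t f_k) the middle factors cancel. *)
Lemma step_mul (i j k : 'I_2) (s t : iso) : unit_iso s -> unit_iso t ->
  iso_mul (step i j s) (step j k t) = step i k (iso_mul s t).
Proof.
case: s t => [[[a b] c] d] [[[a' b'] c'] d'] /unitP hs /unitP ht.
rewrite /step /iso_mul.
by case: (i == ord0); case: (j == ord0); case: (k == ord0); case: hs; case: ht;
  congr (_, _, _, _); lia.
Qed.

Lemma run_mul (s t : iso) (I J K : seq 'I_2) : unit_iso s -> unit_iso t ->
  size I = size J -> size J = size K ->
  iso_mul (run s I J) (run t J K) = run (iso_mul s t) I K.
Proof.
elim: I s t J K => [|i I IH] s t [|j J] [|k K] //= us ut [hIJ] [hJK].
by rewrite IH ?unit_iso_step // step_mul.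
Qed.

Lemma run1_mul (I J K : seq 'I_2) : size I = size J -> size J = size K ->
  iso_mul (run iso1 I J) (run iso1 J K) = run iso1 I K.
Proof. exact: run_mul. Qed.

(** The translations of a map and of its inverse have the same coordinates up to order and sign. *)
Lemma inbox_inv (r : nat) (s t : iso) : inbox r s -> unit_iso t ->
  iso_mul s t = iso1 -> inbox r t.
Proof.
case: s t => [[[a b] c] d] [[[a' b'] c'] d'] /and3P[/unitP hs hc hd] ut [h1 h2 h3 h4].
rewrite /inbox ut /=.
by case: hs hc hd h1 h2 h3 h4; case/unitP: ut => *; lia.
Qed.

Lemma run1_inbox_sym (r : nat) (I J : seq 'I_2) : size I = size J ->
  inbox r (run iso1 I J) -> inbox r (run iso1 J I).
Proof.
move=> hIJ h; apply: (inbox_inv h); first exact: run_unit.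
by rewrite run1_mul // run_id.
Qed.

(** By [run_inj], distinct cells have distinct positions relative to I. The bound does not depend on
    the length of the words. *)
Lemma neighbors_bound (r : nat) (I : seq 'I_2) (L : seq (seq 'I_2)) : uniq L ->
  (forall J, J \in L -> size I = size J /\ inbox r (run iso1 I J)) ->
  (size L <= size (box r))%N.
Proof.
move=> uL hL; rewrite -(size_map (run iso1 I)); apply: uniq_leq_size.
  rewrite map_inj_in_uniq // => J K /hL[hJ _] /hL[hK _] h.
  by have [] := run_inj unit_iso1 unit_iso1 hJ hK h.
by move=> _ /mapP[J /hL[_ h] ->]; exact: mem_box.
Qed.

(* The cell [J] of the [s]-copy is close to the cell [I] of the dragon; on a chain
   of triangles from the latter to the former, [M] is the last cell of the dragon. *)
Lemma near_outside_graph_word (s : iso) (I J : seq 'I_2) : unit_iso s -> s != iso1 ->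
  size I = size J -> inbox 3 (run s I J) ->
  exists M, [/\ size I = size M, graph_word M & inbox 4 (run iso1 I M)].
Proof.
move=> us s1 hIJ hin.
(* [Q t] says that the triangle at position t relative to I is a cell of the dragon itself. *)
pose Q t := exists2 M, size I = size M & run iso1 I M = t.
have [|[M hIM h]|t [g [ht gG [M hM hMt] nQ]]] := @crossing Q _ _ hin.
- by exists I => //; exact: run_id.
- by have [/esym/eqP] := run_inj unit_iso1 us hIM hIJ h; rewrite (negPf s1).
exists M; split => //; last by rewrite hMt.
(* The triangle across the edge is a cell M' of some s'-copy. It is at position g, a vertex of
   [graph], relative to M, and s' = 1 would put it back in Q. *)
have gg := generators_graph gG.
have [s' [M' [us' hM' h']]] := run_surj M (unit_graph gg).
apply: (@graph_word_of_run s' M M'); rewrite ?h' //.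
apply/eqP => s'1; apply: nQ; exists M'; first by rewrite hM.
by rewrite -hMt -h' s'1 run1_mul.
Qed.

(** * Growth of the number of words *)

Definition words (n : nat) : seq (seq 'I_2) := [seq val w | w <- enum {: n.-tuple 'I_2}].

Definition words_in (Q : seq 'I_2 -> Prop) (n : nat) : seq (seq 'I_2) :=
  [seq w <- words n | `[< Q w >]].

Lemma mem_words (n : nat) (I : seq 'I_2) : (I \in words n) = (size I == n).
Proof.
apply/mapP/idP => [[J _ ->]|sI]; first by rewrite size_tuple.
by exists (Tuple sI); rewrite ?mem_enum.
Qed.

Lemma mem_words_in (Q : seq 'I_2 -> Prop) (n : nat) (I : seq 'I_2) :
  I \in words_in Q n <-> size I = n /\ Q I.
Proof.
rewrite mem_filter mem_words; split => [/andP[/asboolP ? /eqP ?]|[/eqP -> ?]] //.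
by rewrite andbT; exact/asboolP.
Qed.

Lemma words_uniq (n : nat) : uniq (words n).
Proof. by rewrite map_inj_uniq ?enum_uniq //; exact: val_inj. Qed.

Lemma words_in_uniq (Q : seq 'I_2 -> Prop) (n : nat) : uniq (words_in Q n).
Proof. exact/filter_uniq/words_uniq. Qed.

Lemma size_words (n : nat) : size (words n) = (2 ^ n)%N.
Proof. by rewrite size_map -cardE card_tuple card_ord. Qed.

Definition growth (n : nat) : nat := size (words_in graph_word n).

Lemma growth_le_exp (n : nat) : (growth n <= 2 ^ n)%N.
Proof. by rewrite -size_words /growth size_filter count_size. Qed.

Lemma growth_gt0 (n : nat) : (0 < growth n)%N.
Proof.
have [I sI gI] := graph_word_nseq n.
have : I \in words_in graph_word n by apply/mem_words_in.
by rewrite /growth; case: (words_in graph_word n).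
Qed.

Lemma growth1 : growth 1 = 2%N.
Proof.
apply/eqP; rewrite eqn_leq (growth_le_exp 1) /=.
apply: (@uniq_leq_size _ [:: [:: ord0]; [:: ord_max]]) => // I.
rewrite !inE => /orP[] /eqP ->; apply/mem_words_in; split => //; exact: graph_word_letter.
Qed.

Lemma growth_submul (m n : nat) : (growth (m + n) <= growth m * growth n)%N.
Proof.
rewrite /growth -(size_allpairs cat); apply: uniq_leq_size (words_in_uniq _ _) _ => I.
move=> /mem_words_in[sI gI]; rewrite -(cat_take_drop m I).
move: gI; rewrite -{1}(cat_take_drop m I) => /graph_word_cat[g1 g2].
apply: allpairs_f; apply/mem_words_in; split => //.
  by rewrite size_takel // sI leq_addr.
by rewrite size_drop sI addKn.
Qed.

(** Deleting the [mixing] letters that follow the first m maps the long words onto all pairs, since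
    any two graph words can be bridged. *)
Lemma growth_supermul (m n : nat) :
  (growth m * growth n <= growth (m + (mixing + n)))%N.
Proof.
rewrite /growth -(size_allpairs pair).
rewrite -(size_map (fun K => (take m K, drop (m + mixing) K)) (words_in graph_word (m + _))).
apply: uniq_leq_size => [|[I J] /allpairsP[[I' J'] [/= hI hJ [-> ->]]]].
  by apply: allpairs_uniq; rewrite ?words_in_uniq // => -[? ?] [? ?].
have [sI gI] := (mem_words_in _ _ _).1 hI; have [sJ gJ] := (mem_words_in _ _ _).1 hJ.
have [P sP gP] := graph_word_mixing gI gJ.
apply/mapP; exists (I' ++ P ++ J').
  by apply/mem_words_in; rewrite !size_cat sI sP sJ.
by rewrite take_size_cat // catA drop_size_cat // size_cat sI sP.
Qed.

Lemma growth_mul_le (m n : nat) :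
  (growth m * growth n <= 2 ^ mixing * growth (m + n))%N.
Proof.
apply: leq_trans (growth_supermul m n) _.
rewrite addnCA; apply: leq_trans (growth_submul _ _) _.
by rewrite leq_pmul2r ?growth_gt0 // growth_le_exp.
Qed.

Lemma growth_exp_ge (n k : nat) :
  (growth n ^ k <= (2 ^ mixing) ^ k * growth (n * k))%N.
Proof.
elim: k => [|k IH]; first by rewrite muln0 !expn0 mul1n growth_gt0.
rewrite mulnS !expnS; apply: leq_trans (leq_mul (leqnn _) IH) _.
by rewrite (mulnC (2 ^ mixing)%N) -mulnA mulnCA leq_mul2l growth_mul_le orbT.
Qed.

Lemma growth_exp_le (n k : nat) : (growth (n * k) <= growth n ^ k)%N.
Proof.
elim: k => [|k IH]; first by rewrite muln0 (growth_le_exp 0).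
by rewrite mulnS expnS; apply: leq_trans (growth_submul _ _) (leq_mul (leqnn _) IH).
Qed.

(** Each block consists of one free letter and one bridge. This exponential growth gives beta >
    1. *)
Lemma growth_ge_exp (k : nat) : (2 ^ k <= growth (mixing.+1 * k))%N.
Proof.
elim: k => [|k IH]; first by rewrite muln0 growth_gt0.
have -> : (mixing.+1 * k.+1 = 1 + (mixing + mixing.+1 * k))%N by rewrite mulnS.
rewrite expnS; apply: leq_trans (growth_supermul _ _).
by rewrite growth1 leq_mul2l IH.
Qed.

(** A variant of Fekete's lemma: every (a n - c) / n is at most every a m / m, and ln beta is taken
    as the supremum of the former. *)
Lemma growth_rate (R : realType) : exists beta : R, 1 < beta /\ forall n,
  beta ^+ n <= (growth n)%:R <= 2 ^+ mixing * beta ^+ n.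
Proof.
pose a n : R := ln (growth n)%:R; pose c : R := mixing%:R * ln 2.
have gp n : 0 < (growth n)%:R :> R by rewrite ltr0n growth_gt0.
have ln2 : 0 < ln 2 :> R by rewrite ln_gt0 // ltr1n.
(* Both sides are compared with ln (growth (n * m)), by [growth_exp_ge] and [growth_exp_le]. *)
have key n m : m%:R * (a n - c) <= n%:R * a m.
  have : (m%:R * a n <= m%:R * c + n%:R * a m).
    rewrite /c mulrA -natrM !mulr_natl -!lnXn // -lnM ?posrE ?exprn_gt0 //.
    rewrite ler_ln ?posrE ?mulr_gt0 ?exprn_gt0 //.
    rewrite -!natrX -natrM ler_nat (mulnC m) expnM.
    apply: leq_trans (growth_exp_ge _ _) _.
    by rewrite leq_mul // mulnC growth_exp_le.
  by rewrite mulrBr lerBlDl.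
pose S := [set (a n.+1 - c) / n.+1%:R | n in setT].
have ub m : ubound S (a m.+1 / m.+1%:R).
  move=> _ [n _ <-]; rewrite ler_pdivrMr // mulrAC ler_pdivlMr // mulrC.
  by rewrite (mulrC (a _)) key.
have S0 : S !=set0 by exists ((a 1 - c) / 1), 0%N.
have hS : has_sup S by split => //; exists (a 1 / 1); exact: ub.
exists (expR (sup S)); split.
  (* At length (mixing + 1)^2 there are at least 2 ^ (mixing + 1) words, more than exp c = 2 ^
     mixing, so this element of S is positive. *)
  rewrite expR_gt1; apply: lt_le_trans (ub_le_sup hS.2 _); last first.
    by exists (mixing.+1 * mixing.+1).-1.
  rewrite prednK ?muln_gt0 // divr_gt0 ?ltr0n // subr_gt0.
  apply: (@lt_le_trans _ _ (ln (2 ^+ mixing.+1))).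
    by rewrite lnXn // -(mulr_natl (ln 2)) /c ltr_pM2r // ltr_nat.
  by rewrite ler_ln ?posrE ?exprn_gt0 // -natrX ler_nat growth_ge_exp.
case=> [|n].
  by rewrite !expr0 mulr1 -natrX ler1n growth_gt0 ler_nat (leq_trans (growth_le_exp 0)).
rewrite -expRM_natl; apply/andP; split.
  rewrite -[leRHS]lnK ?posrE // ler_expR -/(a _) mulrC -ler_pdivlMr //.
  exact: ge_sup.
have -> : 2 ^+ mixing = expR c :> R by rewrite /c expRM_natl lnK ?posrE.
rewrite -expRD -[leLHS]lnK ?posrE // ler_expR -lerBlDl -/(a _) mulrC -ler_pdivrMr //.
by apply: (ub_le_sup hS.2); exists n.
Qed.

(** * Euclidean geometry of the cells *)

Section Geometry.
Context {R : realType}.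
Implicit Types (x y z : R * R) (s t : iso) (I J : seq 'I_2).

Definition act s z : R * R :=
  let: (a, b, c, d) := s in
  (a%:~R * z.1 - b%:~R * z.2 + c%:~R, a%:~R * z.2 + b%:~R * z.1 + d%:~R).

Definition f_seq I : R * R -> R * R := foldr (fun i g => f i \o g) id I.

Definition rho : R := (Num.sqrt 2)^-1.

(** The midpoint of the hypotenuse of T0; the disk of radius 5 / 4 about it contains T0 and the
    dragon. *)
Definition ctr : R * R := (1 / 2, 0).

Lemma act1 z : act iso1 z = z.
Proof. by case: z => x y; rewrite /act /=; congr pair; lra. Qed.

Lemma act_mul s t z : act (iso_mul s t) z = act s (act t z).
Proof.
case: s t => [[[a b] c] d] [[[a' b'] c'] d'].
by rewrite /act /= ?(rmorphD, rmorphB, rmorphM) /=; congr pair; ring.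
Qed.

Lemma act_f i j s z : act s (f j z) = f i (act (step i j s) z).
Proof.
case: s => [[[a b] c] d].
rewrite /f /step; case: (i == ord0); case: (j == ord0); rewrite /act /f1 /f2 /=;
  rewrite ?(rmorphD, rmorphB, rmorphN, rmorph1) /=; congr pair; by field.
Qed.

Lemma act_f_seq s I J z : size I = size J -> act s (f_seq J z) = f_seq I (act (run s I J) z).
Proof.
elim: I J s => [|i I IH] [|j J] s //= [hIJ].
by rewrite (act_f i) IH.
Qed.

Lemma f_seq_cat I J z : f_seq (I ++ J) z = f_seq I (f_seq J z).
Proof. by elim: I => //= i I ->. Qed.

Lemma rho_gt0 : 0 < rho. Proof. by rewrite invr_gt0 sqrtr_gt0. Qed.

Lemma rho_sqr : rho ^+ 2 = 2^-1.
Proof. by rewrite /rho exprVn sqr_sqrtr. Qed.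

Lemma rho_bound : 7 / 10 < rho < 71 / 100.
Proof.
have := rho_sqr; have := rho_gt0; move: rho => r r0 r2.
by apply/andP; split; nra.
Qed.

Lemma edist_ge0 x y : 0 <= edist x y.
Proof. exact: sqrtr_ge0. Qed.

Lemma edist_sqr x y : edist x y ^+ 2 = (x.1 - y.1) ^+ 2 + (x.2 - y.2) ^+ 2.
Proof. by rewrite sqr_sqrtr // addr_ge0 // sqr_ge0. Qed.

Lemma edist_xx x : edist x x = 0.
Proof. by rewrite /edist !subrr expr0n addr0 sqrtr0. Qed.

Lemma edistC x y : edist x y = edist y x.
Proof. by rewrite /edist; congr Num.sqrt; ring. Qed.

Lemma edist_le x y (e : R) : 0 <= e ->
  (edist x y <= e) = ((x.1 - y.1) ^+ 2 + (x.2 - y.2) ^+ 2 <= e ^+ 2).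
Proof. by move=> e0; rewrite -edist_sqr ler_pXn2r // nnegrE edist_ge0. Qed.

Lemma edist_triangle y x z : edist x z <= edist x y + edist y z.
Proof.
rewrite edist_le ?addr_ge0 ?edist_ge0 //.
have := edist_sqr x y; have := edist_sqr y z.
have := edist_ge0 x y; have := edist_ge0 y z.
move: (edist x y) (edist y z) => p q q0 p0.
set a := x.1 - y.1; set b := x.2 - y.2; set c := y.1 - z.1; set d := y.2 - z.2.
have -> : x.1 - z.1 = a + c by rewrite /a /c; ring.
have -> : x.2 - z.2 = b + d by rewrite /b /d; ring.
move=> hq hp.
(* Cauchy-Schwarz, from the Lagrange identity. *)
have : a * c + b * d <= p * q.
  have [|h] := leP (a * c + b * d) 0; first by move/le_trans; apply; exact: mulr_ge0.
  rewrite -(@ler_pXn2r _ 2) // ?nnegrE ?mulr_ge0 ?(ltW h) //.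
  rewrite exprMn hp hq.
  have -> : (a ^+ 2 + b ^+ 2) * (c ^+ 2 + d ^+ 2) =
    (a * c + b * d) ^+ 2 + (a * d - b * c) ^+ 2 by ring.
  by rewrite lerDl sqr_ge0.
nra.
Qed.

Lemma normr1_le_edist x y : `|x.1 - y.1| <= edist x y.
Proof.
by rewrite -sqrtr_sqr ler_sqrt ?lerDl ?sqr_ge0 // addr_ge0 ?sqr_ge0.
Qed.

Lemma normr2_le_edist x y : `|x.2 - y.2| <= edist x y.
Proof.
by rewrite -sqrtr_sqr ler_sqrt ?lerDr ?sqr_ge0 // addr_ge0 ?sqr_ge0.
Qed.

Lemma edist_le_normD x y : edist x y <= `|x.1 - y.1| + `|x.2 - y.2|.
Proof.
rewrite edist_le ?addr_ge0 ?normr_ge0 //.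
rewrite -(real_normK (num_real (x.1 - y.1))) -(real_normK (num_real (x.2 - y.2))).
have := normr_ge0 (x.1 - y.1); have := normr_ge0 (x.2 - y.2); nra.
Qed.

Lemma edist_act s x y : unit_iso s -> edist (act s x) (act s y) = edist x y.
Proof.
case: s => [[[a b] c] d] /unitP us; rewrite /edist /act /=; congr Num.sqrt.
by case: us; rewrite ?rmorphN ?rmorph1 ?rmorph0; ring.
Qed.

Lemma edist_f i x y : edist (f i x) (f i y) = rho * edist x y.
Proof.
have h : Num.sqrt (rho ^+ 2) = rho by rewrite sqrtr_sqr gtr0_norm ?rho_gt0.
rewrite -h /edist -sqrtrM ?sqr_ge0 // rho_sqr; congr Num.sqrt.
by rewrite /f; case: (i == ord0); rewrite /f1 /f2 /=; field.
Qed.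

Lemma edist_f_seq I x y : edist (f_seq I x) (f_seq I y) = rho ^+ size I * edist x y.
Proof.
elim: I => [|i I IH] /=; first by rewrite mul1r.
by rewrite edist_f IH exprS mulrA.
Qed.

Lemma f_seq_surj I y : exists x, f_seq I x = y.
Proof.
elim: I y => [|i I IH] y; first by exists y.
suff [z hz] : exists z, f i z = y.
  by have [x hx] := IH z; exists x; rewrite /= hx.
rewrite /f; case: (i == ord0).
  exists (y.1 + y.2, y.2 - y.1); rewrite /f1 /=.
  by rewrite [RHS]surjective_pairing; congr pair; field.
exists (y.1 - y.2, y.1 + y.2 - 1); rewrite /f2 /=.
by rewrite [RHS]surjective_pairing; congr pair; field.
Qed.

Lemma edist_eq0 x y : edist x y = 0 -> x = y.
Proof.
move=> h; have := normr1_le_edist x y; have := normr2_le_edist x y.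
rewrite h !normr_le0 !subr_eq0 => /eqP h2 /eqP h1.
by rewrite [LHS]surjective_pairing h1 h2 -surjective_pairing.
Qed.

Lemma f_seq_inj I : injective (f_seq I).
Proof.
move=> x y h; apply: edist_eq0.
have /esym/eqP := edist_f_seq I x y; rewrite h edist_xx mulf_eq0.
by rewrite expf_eq0 gt_eqF ?rho_gt0 // andbF => /eqP.
Qed.

(** For a unit u the coordinates of (u - 1) / 2 are at most 1 in absolute value. The margin 1 / 4
    therefore gives |c|, |d| < r + 1, and c, d are integers. *)
Lemma inbox_close (r : nat) s : unit_iso s ->
  edist (act s ctr) ctr <= r%:R - 1 / 4 -> inbox r s.
Proof.
case: s => [[[a b] c] d] us h.
have := le_trans (normr1_le_edist _ _) h; have := le_trans (normr2_le_edist _ _) h.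
rewrite /act /ctr /inbox us /= !ler_norml => /andP[h1 h2] /andP[h3 h4].
have small (k : int) : - r%:R - 1 < k%:~R :> R -> k%:~R < r%:R + 1 :> R -> (`|k| <= r)%N.
  have -> : - r%:R - 1 = (- r%:Z - 1)%:~R :> R by rewrite rmorphB rmorphN.
  have -> : r%:R + 1 = (r%:Z + 1)%:~R :> R by rewrite rmorphD.
  by rewrite !ltr_int; lia.
by apply/andP; split; apply: small; case/unitP: us h1 h2 h3 h4 => *; lra.
Qed.

End Geometry.

(** * Euclidean neighborhoods, the tiling by triangles, and nearby cells *)

Section Dragon.
Context {R : realType}.
Implicit Types (x y z : R * R) (s t : iso) (I J : seq 'I_2).

Lemma nbhs_edist x (U : set (R * R)) :
  nbhs x U <-> exists2 e : R, 0 < e & forall y, edist x y < e -> U y.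
Proof.
split => [/nbhs_ballP[e /= e0 h]|[e e0 h]]; last apply/nbhs_ballP.
  exists e => // y hy; apply: h; split => /=.
    exact: le_lt_trans (normr1_le_edist _ _) hy.
  exact: le_lt_trans (normr2_le_edist _ _) hy.
exists (e / 2) => /=; first by rewrite divr_gt0.
move=> y [h1 h2]; apply: h; apply: le_lt_trans (edist_le_normD _ _) _.
by rewrite [e]splitr ltrD.
Qed.

Lemma exists_rho_exp (C e : R) : 0 < e -> exists n, rho ^+ n * C < e.
Proof.
move=> e0.
have h : (fun n => C * rho ^+ n) @ \oo --> C * 0.
  apply: cvgM; first exact: cvg_cst.
  apply: cvg_expr; rewrite gtr0_norm ?rho_gt0 //.
  by have /andP[_] := @rho_bound R; lra.
rewrite mulr0 in h.
have /cvgr_lt /(_ _ e0) [N _ hN] := h.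
by exists N; rewrite mulrC; apply: (hN N) => /=.
Qed.

Lemma closed_edist (A : set (R * R)) x : closed A ->
  (forall e : R, 0 < e -> exists2 y, A y & edist x y < e) -> A x.
Proof.
move=> clA h; apply: clA => U /nbhs_edist[e e0 hU].
by have [y Ay hy] := h e e0; exists y; split => //; exact: hU.
Qed.

Lemma T0P z : T0 z <-> [/\ 0 <= z.2, z.2 <= z.1 & z.2 <= 1 - z.1].
Proof.
split => [[a [b [c [a0 b0 c0 h ->]]]] /=|[h1 h2 h3]].
  by rewrite /GRing.scale /=; split; lra.
exists (1 - z.1 - z.2), (2 * z.2), (z.1 - z.2); split; [lra | lra | lra | lra |].
rewrite [LHS]surjective_pairing [RHS]surjective_pairing /=.
by congr pair; rewrite /GRing.scale /=; field.
Qed.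

(** The diagonals of the unit square around y cut it into four copies of T0. *)
Lemma tiling y : exists s z, [/\ unit_iso s, T0 z & y = act s z].
Proof.
case: y => x y.
have := floor_itv x; have := floor_itv y.
move: (Num.floor x) (Num.floor y) => c d; rewrite !intrD.
move=> /andP[hy0 hy1] /andP[hx0 hx1].
pose u := x - c%:~R; pose v := y - d%:~R.
have [hvu|hvu] := leP v u; have [hv|hv] := leP v (1 - u).
- exists (1, 0, c, d), (u, v); split => //.
    by apply/T0P; rewrite /= /u /v in hvu hv *; split; lra.
  by rewrite /act /=; congr pair; rewrite /u /v; ring.
- exists (0, 1, c + 1, d), (v, 1 - u); split => //.
    by apply/T0P; rewrite /= /u /v in hvu hv *; split; lra.
  by rewrite /act /= !intrD; congr pair; rewrite /u /v; ring.
- exists (0, -1, c, d + 1), (1 - v, u); split => //.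
    by apply/T0P; rewrite /= /u /v in hvu hv *; split; lra.
  by rewrite /act /= !intrD; congr pair; rewrite /u /v; ring.
- exists (-1, 0, c + 1, d + 1), (1 - u, 1 - v); split => //.
    by apply/T0P; rewrite /= /u /v in hvu hv *; split; lra.
  by rewrite /act /= !intrD; congr pair; rewrite /u /v; ring.
Qed.

Lemma edist_f_ctr i : edist (f i ctr) ctr = rho * (1 / 2) :> R.
Proof.
have h : Num.sqrt ((rho * (1 / 2)) ^+ 2) = rho * (1 / 2) :> R.
  by rewrite sqrtr_sqr gtr0_norm // mulr_gt0 ?rho_gt0.
rewrite -h exprMn rho_sqr /edist; congr Num.sqrt.
by rewrite /f /ctr; case: (i == ord0); rewrite /f1 /f2 /=; field.
Qed.

(** The radius works because rho * (5 / 4 + 1 / 2) <= 5 / 4. *)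
Lemma edist_ball_f i z : edist z ctr <= 5 / 4 -> edist (f i z) ctr <= 5 / 4.
Proof.
move=> hz; apply: le_trans (edist_triangle (f i ctr) _ _) _.
rewrite edist_f edist_f_ctr.
have /andP[r0 r1] := @rho_bound R; nra.
Qed.

Lemma edist_ball_f_seq I z : edist z ctr <= 5 / 4 -> edist (f_seq I z) ctr <= 5 / 4.
Proof. by move=> hz; elim: I => //= i I; exact: edist_ball_f. Qed.

Lemma T0_ball z : T0 z -> edist z ctr <= 5 / 4.
Proof.
move=> /T0P[h1 h2 h3]; rewrite edist_le; last lra.
rewrite /ctr /=; nra.
Qed.

(* 5 / 4 + 1 / 4 + 5 / 4 is the bound 3 - 1 / 4 of [inbox_close]. *)
Lemma near_cells I s J z w (x y : R * R) : unit_iso s -> size I = size J ->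
  edist z ctr <= 5 / 4 -> edist w ctr <= 5 / 4 -> x = f_seq I z -> y = act s (f_seq J w) ->
  edist x y <= rho ^+ size I * (1 / 4) -> inbox 3 (run s I J).
Proof.
move=> us hIJ hz hw -> ->; rewrite (act_f_seq _ _ hIJ) edist_f_seq ler_pM2l; last first.
  by rewrite exprn_gt0 ?rho_gt0.
move=> h; have ur := run_unit I J us.
apply: (@inbox_close R) => //.
apply: le_trans (edist_triangle (act (run s I J) w) _ _) _.
rewrite edist_act // (edistC ctr).
apply: le_trans (lerD (lexx _) (edist_triangle z _ _)) _.
by rewrite (edistC _ z); lra.
Qed.

Lemma inbox_edist r s : inbox r s -> edist ctr (act s ctr) <= 2 * r%:R + 2 :> R.
Proof.
case: s => [[[a b] c] d] /and3P[us hc hd].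
have bnd (k : int) : (`|k| <= r)%N -> -r%:R <= (k%:~R : R) <= r%:R.
  move=> hk; rewrite -[r%:R]mulrz_nat -mulrNz !ler_int.
  by apply/andP; split; lia.
have /andP[c0 c1] := bnd _ hc; have /andP[d0 d1] := bnd _ hd.
apply: le_trans (edist_le_normD _ _) _.
rewrite /ctr /act /=.
set p := 1 / 2 - _; set q := 0 - _.
have /andP[p0 p1] : - (r%:R + 1) <= p <= r%:R + 1.
  by rewrite /p; case/unitP: us; apply/andP; split; lra.
have /andP[q0 q1] : - (r%:R + 1) <= q <= r%:R + 1.
  by rewrite /q; case/unitP: us; apply/andP; split; lra.
have := ler_norml p (r%:R + 1); rewrite p0 p1 /= => hp.
have := ler_norml q (r%:R + 1); rewrite q0 q1 /= => hq; lra.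
Qed.

End Dragon.

(** * The dragon and its boundary *)

Section LevyK.
Context {R : realType} (K : set (R * R)) (levyK : is_levy_dragon K).
Implicit Types (x y z : R * R) (s t : iso) (I J : seq 'I_2).

Lemma iter_F (X : set (R * R)) n x :
  iter n F X x <-> exists I z, [/\ size I = n, X z & x = f_seq I z].
Proof.
elim: n x => [|n IH] x /=.
  split=> [Xx|[I [z [/size0nil -> Xz ->]]]] //.
  by exists [::], x.
split=> [[[y hy <-]|[y hy <-]]|[[|i I] [z [//= [hI] Xz ->]]]].
- have [I [z [hI Xz ->]]] := (IH _).1 hy.
  by exists (ord0 :: I), z; split; rewrite /= ?hI.
- have [I [z [hI Xz ->]]] := (IH _).1 hy.
  by exists (ord_max :: I), z; split; rewrite /= ?hI.
have hz : iter n F X (f_seq I z) by apply/IH; exists I, z.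
by case: (letterP i); [left|right]; exists (f_seq I z).
Qed.

Lemma dragon_iter n : iter n F K = K.
Proof. by have [_ _ FK] := levyK; elim: n => //= n ->. Qed.

Lemma dragon_f_seq I z : K z -> K (f_seq I z).
Proof. by move=> Kz; rewrite -(dragon_iter (size I)); apply/iter_F; exists I, z. Qed.

Lemma dragon_split n x : K x -> exists I z, [/\ size I = n, K z & x = f_seq I z].
Proof. by rewrite -{1}(dragon_iter n) => /iter_F. Qed.

Lemma dragon_closed : closed K.
Proof.
by have [_ cK _] := levyK; apply: compact_closed.
Qed.

(** Compactness gives some bound; writing points of K as f_i(v) with v in K multiplies the excess
    over 5 / 4 by rho, as often as desired. *)
Lemma dragon_ball z : K z -> edist z ctr <= 5 / 4.
Proof.
have [_ cK _] := levyK.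
have [M [_ hM]] := compact_bounded cK.
have {}hM w : K w -> edist w ctr <= 5 / 4 + 2 * (`|M| + 2).
  move=> Kw; have : `|w| <= `|M| + 1.
    by apply: hM => //; apply: le_lt_trans (ler_norm M) _; rewrite ltrDl.
  rewrite prod_normE ge_max => /andP[h1 h2].
  apply: le_trans (edist_le_normD _ _) _; rewrite /ctr /= subr0.
  have := ler_normB w.1 (1 / 2); rewrite (@ger0_norm _ (1 / 2)) //; lra.
move=> Kz; apply/ler_addgt0Pl => e e0.
have [n hn] := @exists_rho_exp R (2 * (`|M| + 2)) _ e0.
suff h m w : K w -> edist w ctr <= 5 / 4 + rho ^+ m * (2 * (`|M| + 2)).
  apply: le_trans (h n z Kz) _; lra.
elim: m w => [|m IH] w Kw; first by rewrite mul1r; exact: hM.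
have [I [v [sI Kv ->]]] := dragon_split 1 Kw.
case: I sI => [|i [|//]] //= _.
apply: le_trans (edist_triangle (f i ctr) _ _) _; rewrite edist_f exprS.
have := IH v Kv; have /andP[r0 r1] := @rho_bound R.
rewrite edist_f_ctr; set q := rho ^+ m * _; move=> hq.
by rewrite -mulrA -/q; nra.
Qed.

(** 0 is the fixed point of [f1], hence the limit of the points f_1^n(z) of K. *)
Lemma dragon0 : K (0, 0).
Proof.
have [[z Kz] _ _] := levyK; apply: closed_edist dragon_closed _ => e e0.
have [n hn] := @exists_rho_exp R (edist (0, 0) z) _ e0.
exists (f_seq (nseq n ord0) z); first exact: dragon_f_seq.
have {1}-> : (0, 0) = f_seq (nseq n ord0) (0, 0) :> R * R.
  by elim: n {hn} => //= n <-; rewrite /f /= /f1 /=; congr pair; field.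
by rewrite edist_f_seq size_nseq.
Qed.

Lemma dragon_near_inbox s z w : unit_iso s -> K z -> K w -> z = act s w -> inbox 3 s.
Proof.
move=> us Kz Kw h.
have := @near_cells R [::] s [::] z w z z us erefl (dragon_ball Kz) (dragon_ball Kw) erefl h.
by apply; rewrite edist_xx expr0; lra.
Qed.

(** If x were interior to K, then K would contain a point of the s-copy with address L ++
    [interior_word], L being a long prefix of an address of w. Moved back by s^-1, this point lies
    in K and in another copy, against [interior_wordP]. *)
Lemma dragon_boundary s x w : unit_iso s -> s != iso1 -> K w -> K x ->
  x = act s w -> boundary K x.
Proof.
move=> us s1 Kw Kx hx; split; first exact: subset_closure.
move=> /nbhs_edist[e e0 he].
(* 5 / 2 is the diameter of the disk that contains K. *)
have [n hn] := @exists_rho_exp R (5 / 2) _ e0.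
have [L [v [sL Kv hw]]] := dragon_split n Kw.
set W := interior_word.
have : K (act s (f_seq (L ++ W) (0, 0))).
  apply: he; rewrite hx hw edist_act // f_seq_cat edist_f_seq sL.
  apply: le_lt_trans hn; rewrite ler_wpM2l ?exprn_ge0 ?(ltW rho_gt0) //.
  apply: le_trans (edist_triangle ctr _ _) _; rewrite (edistC ctr).
  have := dragon_ball Kv; have := dragon_ball (dragon_f_seq W dragon0); lra.
move=> /(dragon_split (n + size W))[M [z [sM Kz hM]]].
have [s' us' hs'] := unit_iso_inv us.
have s'1 : s' != iso1.
  by apply: contraNneq s1 => h; move: hs'; rewrite h iso_mul1g => ->.
have {}hM : f_seq (L ++ W) (0, 0) = act s' (f_seq M z).
  by rewrite -hM -act_mul hs' act1.
have sL' : size L = size (take n M) by rewrite size_takel ?sL // sM leq_addr.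
have sW : size W = size (drop n M) by rewrite size_drop sM addKn.
pose t := run s' L (take n M).
have hW : f_seq W (0, 0) = act t (f_seq (drop n M) z).
  apply: (@f_seq_inj R L); rewrite -f_seq_cat hM -{1}(cat_take_drop n M) f_seq_cat.
  by rewrite (act_f_seq _ _ sL').
have ut : unit_iso t by exact: run_unit.
apply: (@interior_wordP t (drop n M)) => // [|k]; first exact: run_neq1.
apply: (@dragon_near_inbox _ (f_seq (drop k W) (0, 0)) (f_seq (drop k (drop n M)) z)).
- exact: run_unit.
- exact/dragon_f_seq/dragon0.
- exact: dragon_f_seq.
apply: (@f_seq_inj R (take k W)); rewrite -f_seq_cat cat_take_drop hW.
rewrite -act_f_seq; last by rewrite !size_take_min sW.
by rewrite -f_seq_cat cat_take_drop.
Qed.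

Lemma graph_word_boundary I : graph_word I -> exists x w, [/\ boundary K x, K w & x = f_seq I w].
Proof.
move=> /graph_word_hub[s [J [P [us s1 sP sIP hrun]]]].
exists (f_seq (I ++ P) (0, 0)), (f_seq P (0, 0)); split; last by rewrite f_seq_cat.
  apply: (dragon_boundary us s1 (dragon_f_seq J dragon0) (dragon_f_seq _ dragon0)).
  rewrite (act_f_seq _ _ sIP) hrun; congr f_seq.
  by rewrite /act /hub /=; congr pair; ring.
exact/dragon_f_seq/dragon0.
Qed.

Lemma near_graph_word I s J z w x y : unit_iso s -> s != iso1 -> size I = size J ->
  edist z ctr <= 5 / 4 -> edist w ctr <= 5 / 4 -> x = f_seq I z -> y = act s (f_seq J w) ->
  edist x y <= rho ^+ size I * (1 / 4) ->
  exists M, [/\ size I = size M, graph_word M & inbox 4 (run iso1 I M)].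
Proof.
move=> us s1 hIJ hz hw hx hy hxy; apply: (near_outside_graph_word us s1 hIJ).
exact: (near_cells us hIJ hz hw hx hy hxy).
Qed.

(** Near x there is a point y outside K. A triangle around y, smaller than the distance from y to K,
    belongs to another copy, and its ancestor of level n is close to the cell of x. *)
Lemma boundary_near_graph_word n x : boundary K x ->
  exists M, [/\ size M = n, graph_word M & edist x (f_seq M ctr) <= rho ^+ n * 12].
Proof.
have rn k : 0 < rho ^+ k :> R by rewrite exprn_gt0 ?rho_gt0.
move=> [clKx nintx].
have Kx : K x by move: clKx; rewrite -(closure_id K).1 //; exact: dragon_closed.
have [I [z [sI Kz hx]]] := dragon_split n Kx.
have [y hxy nKy] : exists2 y, edist x y < rho ^+ n * (1 / 4) & ~ K y.
  apply: contrapT => hno; apply: nintx; apply/nbhs_edist.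
  exists (rho ^+ n * (1 / 4)); first by rewrite mulr_gt0.
  by move=> y hxy; apply: contrapT => nKy; apply: hno; exists y.
have [e e0 he] : exists2 e : R, 0 < e & forall y', K y' -> e <= edist y y'.
  apply: contrapT => hno; apply: nKy; apply: closed_edist dragon_closed _ => e e0.
  apply: contrapT => hno'; apply: hno; exists e => // y' Ky'.
  by rewrite leNgt; apply/negP => hy'; apply: hno'; exists y'.
have [m hm] := @exists_rho_exp R (5 / 2) _ e0.
(* Any word of this length would do: it only fixes the size of the triangle around y. *)
pose L0 := nseq (n + m) (ord0 : 'I_2).
have [v hv] := f_seq_surj L0 y.
have [t [w [ut Tw hw]]] := tiling v.
have [s [J [us hJ hrun]]] := run_surj L0 ut.
have hy : y = act s (f_seq J w) by rewrite (act_f_seq _ _ hJ) hrun -hw hv.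
have sJ : size J = (n + m)%N by rewrite -hJ size_nseq.
have s1 : s != iso1.
  apply/eqP => s1; have := he _ (dragon_f_seq J dragon0).
  rewrite hy s1 act1 edist_f_seq sJ; apply/negP; rewrite -ltNge.
  apply: le_lt_trans hm; apply: ler_pM => //.
  - by rewrite exprn_ge0 // ltW // rho_gt0.
  - exact: edist_ge0.
  - rewrite addnC exprD ger_pMr //; apply: exprn_ile1; first exact/ltW/rho_gt0.
    by have /andP[_] := @rho_bound R; lra.
  - apply: le_trans (edist_triangle ctr _ _) _; rewrite (edistC ctr).
    have := T0_ball Tw; have := dragon_ball dragon0; lra.
have hIJ : size I = size (take n J) by rewrite size_takel ?sI // sJ leq_addr.
have hw' := edist_ball_f_seq (drop n J) (T0_ball Tw).
have hy' : y = act s (f_seq (take n J) (f_seq (drop n J) w)).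
  by rewrite -f_seq_cat cat_take_drop.
have hxy' : edist x y <= rho ^+ size I * (1 / 4) by rewrite sI ltW.
have [M [hIM gM hin]] := near_graph_word us s1 hIJ (dragon_ball Kz) hw' hx hy' hxy'.
exists M; split => //; first by rewrite -hIM.
have -> : f_seq M ctr = f_seq I (act (run iso1 I M) ctr) :> R * R.
  by rewrite -act_f_seq // act1.
rewrite hx edist_f_seq sI ler_pM2l //.
(* 5 / 4 for the dragon and 2 * 4 + 2 for box 4 add up to less than 12. *)
apply: le_trans (edist_triangle ctr _ _) _.
have := dragon_ball Kz; have := @inbox_edist R _ _ hin; lra.
Qed.

End LevyK.

(** * The words of B *)

Lemma size_cover (T T' : eqType) (r : T' -> T -> bool) (L : seq T) (G : seq T') :
  (forall x, x \in L -> exists2 y, y \in G & r y x) ->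
  (size L <= \sum_(y <- G) size [seq x <- L | r y x])%N.
Proof.
elim: G L => [|y G IH] L hL.
  by rewrite big_nil; case: L hL => // x L /(_ x (mem_head _ _)) [].
rewrite big_cons -(count_predC (r y) L) -!size_filter leq_add2l.
apply: leq_trans (IH _ _) _ => [x|].
  rewrite mem_filter /= => /andP[nr /hL[z]]; rewrite inE => /orP[/eqP ->|zG hz].
    by rewrite (negPf nr).
  by exists z.
apply: leq_sum => z _; rewrite [leqLHS]size_filter count_filter size_filter.
by apply: sub_count => x /andP[].
Qed.

Section BoundaryWords.
Context {R : realType}.
Implicit Types (x y z : R * R) (s t : iso) (I J : seq 'I_2).

Definition boundary_word I : Prop :=
  (f_seq I @` T0) `&` boundary (iter (size I) F (T0 : set (R * R))) !=set0.

Lemma card_B n : #|B R n| = size (words_in boundary_word n).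
Proof.
rewrite cardE -(size_map val); apply: perm_size; apply: uniq_perm.
- by rewrite map_inj_uniq ?enum_uniq //; exact: val_inj.
- exact: words_in_uniq.
move=> I; apply/mapP/idP => [[w]|/mem_words_in[/eqP sI bI]].
  rewrite mem_enum inE => /asboolP hw ->.
  by apply/mem_words_in; rewrite /boundary_word size_tuple.
exists (Tuple sI) => //; rewrite mem_enum inE; apply/asboolP.
by move: bI; rewrite /boundary_word (eqP sI).
Qed.

(** Near a boundary point of F^n(T0) there is a point outside F^n(T0), and a triangle of the same
    level around it belongs to another copy. *)
Lemma boundary_word_near_graph_word I : boundary_word I ->
  exists M, [/\ size I = size M, graph_word M & inbox 4 (run iso1 I M)].
Proof.
have rn k : 0 < rho ^+ k :> R by rewrite exprn_gt0 ?rho_gt0.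
move=> [_ [[z Tz <-] [_ nint]]].
have [y hxy nFy] : exists2 y, edist (f_seq I z) y < rho ^+ size I * (1 / 4) &
    ~ iter (size I) F T0 y.
  apply: contrapT => hno; apply: nint; apply/nbhs_edist.
  exists (rho ^+ size I * (1 / 4)); first by rewrite mulr_gt0.
  by move=> y hxy; apply: contrapT => nFy; apply: hno; exists y.
have [v hv] := f_seq_surj I y.
have [t [w [ut Tw hw]]] := tiling v.
have [s [J [us hJ hrun]]] := run_surj I ut.
have hy : y = act s (f_seq J w) by rewrite (act_f_seq _ _ hJ) hrun -hw hv.
have s1 : s != iso1.
  by apply/eqP => s1; apply: nFy; apply/iter_F; exists J, w; rewrite hy s1 act1.
exact: (near_graph_word us s1 hJ (T0_ball Tz) (T0_ball Tw) erefl hy (ltW hxy)).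
Qed.

(** The point (2e, e) is interior to T0, so no other triangle of the tiling contains it. *)
Lemma T0_inner t (e : R) : unit_iso t -> 0 < e -> e < 1 / 8 ->
  T0 (act t (2 * e, e)) -> t = iso1.
Proof.
case: t => [[[a b] c] d] /unitP ut e0 e8 /T0P[]; rewrite /act /= => h1 h2 h3.
have pos (k : int) : -1 < k%:~R :> R -> 0 <= k.
  by rewrite -[-1]/((-1)%:~R) ltr_int; lia.
have neg (k : int) : k%:~R < 1 :> R -> k <= 0.
  by rewrite -[1]/(1%:~R) ltr_int; lia.
have no (k : int) : 0 < k%:~R :> R -> k%:~R < 1 :> R -> False.
  by move=> k0 /neg; move: k0; rewrite -[0]/(0%:~R) ltr_int; lia.
case: ut h1 h2 h3 => h1 h2 h3.
- have [c0 c1 d0 d1] : [/\ 0 <= c, c <= 0, 0 <= d & d <= 0].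
    by split; (apply: pos || apply: neg); lra.
  by congr (_, _, _, _); lia.
- have d0 : 0 <= d%:~R :> R by rewrite ler0z; apply: pos; lra.
  by case: (no c); lra.
- by case: (no d); lra.
- by case: (no d); lra.
Qed.

(** At [hub] the image of the vertex 0 is also a vertex of a triangle of another copy. Inner points
    of that triangle approach it from outside F^n(T0). *)
Lemma graph_word_boundary_word I : graph_word I ->
  exists2 P, size P = mixing & boundary_word (I ++ P).
Proof.
move=> /graph_word_hub[s [J [P [us s1 sP sIP hrun]]]]; exists P => //.
have T00 : T0 ((0, 0) : R * R) by apply/T0P => /=; split; lra.
have h0 : act s (f_seq J (0, 0)) = f_seq (I ++ P) (0, 0) :> R * R.
  rewrite (act_f_seq _ _ sIP) hrun; congr f_seq.
  by rewrite /act /hub /=; congr pair; ring.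
exists (f_seq (I ++ P) (0, 0)); split; first by exists (0, 0).
split; first by apply: subset_closure; apply/iter_F; exists (I ++ P), (0, 0).
move=> /nbhs_edist[e e0 he].
(* d <= e / 4 makes 3d < e, and d <= 1 / 16 meets the condition of [T0_inner]. *)
pose d := Num.min (1 / 16) (e / 4).
have d0 : 0 < d by rewrite lt_min; apply/andP; split; lra.
have [d1 d2] : d <= 1 / 16 /\ d <= e / 4 by rewrite /d !ge_min !lexx orbT.
have /he : edist (f_seq (I ++ P) (0, 0)) (act s (f_seq J (2 * d, d))) < e.
  rewrite -h0 edist_act // edist_f_seq.
  have hr : rho ^+ size J <= 1 :> R.
    apply: exprn_ile1; first exact/ltW/rho_gt0.
    by have /andP[_] := @rho_bound R; lra.
  have : edist (0, 0) (2 * d, d) <= 3 * d.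
    apply: le_trans (edist_le_normD _ _) _ => /=.
    by rewrite !sub0r !normrN !gtr0_norm ?mulr_gt0 //; lra.
  have := edist_ge0 (0, 0) (2 * d, d); nra.
move=> /iter_F[M [z [sM Tz hz]]].
have sMJ : size M = size J by rewrite sM.
have := @T0_inner (run s M J) d (run_unit _ _ us) d0 _ _.
have -> : act (run s M J) (2 * d, d) = z.
  by apply: (@f_seq_inj R M); rewrite -act_f_seq.
move=> /(_ _ Tz) h; have /eqP := run_neq1 us sMJ s1; apply; apply: h; lra.
Qed.

Lemma card_B_le n : (#|B R n| <= size (box 4) * growth n)%N.
Proof.
rewrite card_B.
have h I : I \in words_in boundary_word n ->
    exists2 M, M \in words_in graph_word n & inbox 4 (run iso1 M I).
  move=> /mem_words_in[sI /boundary_word_near_graph_word[M [hIM gM hin]]].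
  exists M; last exact: run1_inbox_sym.
  by apply/mem_words_in; rewrite -hIM.
apply: leq_trans (size_cover h) _.
rewrite -iter_addn_0 /growth -(count_predT (words_in graph_word n)) -big_const_seq.
rewrite big_seq [leqRHS]big_seq; apply: leq_sum => M /mem_words_in[sM _].
apply: (@neighbors_bound 4 M); first exact/filter_uniq/words_in_uniq.
by move=> J; rewrite mem_filter => /andP[hin /mem_words_in[sJ _]]; rewrite sM sJ.
Qed.

Lemma growth_le_card_B n : (growth n <= #|B R (n + mixing)|)%N.
Proof.
rewrite card_B -(size_map (take n)); apply: uniq_leq_size; first exact: words_in_uniq.
move=> I /mem_words_in[sI /graph_word_boundary_word[P sP bP]].
apply/mapP; exists (I ++ P); last by rewrite -sI take_size_cat.
by apply/mem_words_in; rewrite size_cat sI sP.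
Qed.

Lemma cvg_root_const (c : R) : 0 < c -> c `^ n%:R^-1 @[n --> \oo] --> (1 : R).
Proof.
move=> c0.
have h : (n%:R^-1 : R) @[n --> \oo] --> (0 : R).
  by apply/gtr0_cvgV0; [near=> n; rewrite ltr0n; near: n; exact: nbhs_infty_gt | exact: cvgr_idn].
have : expR (n%:R^-1 * ln c) @[n --> \oo] --> expR (0 * ln c).
  by apply: continuous_cvg; [exact: continuous_expR | apply: cvgM; [exact: h | exact: cvg_cst]].
rewrite mul0r expR0; apply: cvg_trans.
by apply: near_eq_cvg; near=> n; rewrite /powR (gt_eqF c0).
Unshelve. all: by end_near. Qed.

Lemma cvg_root_geometric (u : nat -> R) (c C b : R) : 0 < c -> 0 < C -> 0 < b ->
  (\forall n \near \oo, c * b ^+ n <= u n <= C * b ^+ n) ->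
  u n `^ n%:R^-1 @[n --> \oo] --> b.
Proof.
move=> c0 C0 b0 hu.
have root a n : 0 < a -> (0 < n)%N -> (a * b ^+ n) `^ n%:R^-1 = a `^ n%:R^-1 * b.
  move=> a0 n0; rewrite powRM ?exprn_ge0 ?ltW // -powR_mulrn ?ltW // -powRrM.
  by rewrite divff ?powRr1 ?ltW // pnatr_eq0 -lt0n.
have lim a : 0 < a -> (a * b ^+ n) `^ n%:R^-1 @[n --> \oo] --> b.
  move=> a0.
  have : a `^ n%:R^-1 * b @[n --> \oo] --> 1 * b.
    by apply: cvgM; [exact: cvg_root_const | exact: cvg_cst].
  rewrite mul1r; apply: cvg_trans.
  apply: near_eq_cvg; near=> n; rewrite root //; near: n; exact: nbhs_infty_gt.
apply: squeeze_cvgr (lim c c0) (lim C C0).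
near=> n.
have /andP[h1 h2] : c * b ^+ n <= u n <= C * b ^+ n by near: n.
have p0 : 0 <= c * b ^+ n by rewrite mulr_ge0 ?exprn_ge0 // ltW.
have p1 := le_trans p0 h1; have p2 := le_trans p1 h2.
have i0 : 0 <= n%:R^-1 :> R by rewrite invr_ge0.
by rewrite !ge0_ler_powR.
Unshelve. all: by end_near. Qed.

Lemma cvg_card_B (beta C : R) : 1 < beta -> 0 < C ->
  (forall n, beta ^+ n <= (growth n)%:R <= C * beta ^+ n) ->
  (#|B R n|%:R : R) `^ n%:R^-1 @[n --> \oo] --> beta.
Proof.
move=> b1 C0 hb; have b0 : 0 < beta by apply: lt_trans b1.
have N0 : 0 < (size (box 4))%:R :> R by rewrite ltr0n.
(* The factor [beta ^- mixing] absorbs the shift of length in [growth_le_card_B]. *)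
apply: (@cvg_root_geometric _ (beta ^- mixing) ((size (box 4))%:R * C)) => //.
- by rewrite invr_gt0 exprn_gt0.
- exact: mulr_gt0.
near=> n; apply/andP; split; last first.
  rewrite -mulrA; apply: (@le_trans _ _ ((size (box 4))%:R * (growth n)%:R)).
    by rewrite -natrM ler_nat card_B_le.
  by rewrite ler_pM2l //; have /andP[] := hb n.
have hn : (mixing <= n)%N by near: n; exact: nbhs_infty_ge.
rewrite -{1}(subnK hn) addnC exprD mulKf ?expf_neq0 ?gt_eqF //.
have /andP[h _] := hb (n - mixing)%N; apply: le_trans h _.
by rewrite ler_nat -[X in #|B R X|](subnK hn) growth_le_card_B.
Unshelve. all: by end_near. Qed.

End BoundaryWords.

(** * Hausdorff measure of the boundary *)

Section Covers.
Context {R : realType}.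
Implicit Types (U : set (R * R)) (s r : R).

Lemma diam_le U r : (forall p q, U p -> U q -> edist p q <= r) -> (diam U <= r%:E)%E.
Proof.
move=> h; apply: ge_ereal_sup => _ [p Up [q Uq <-]].
by rewrite lee_fin h.
Qed.

Lemma le_diam U p q : U p -> U q -> ((edist p q)%:E <= diam U)%E.
Proof. by move=> Up Uq; apply: ereal_sup_ubound; exists p => //; exists q. Qed.

Lemma diam_pow_ge0 s U : (0 <= diam_pow s U)%E.
Proof. by rewrite /diam_pow; case: ifP => // _; exact: poweR_ge0. Qed.

Lemma diam_pow_le s U r : 0 <= s -> 0 <= r -> (diam U <= r%:E)%E ->
  (diam_pow s U <= (r `^ s)%:E)%E.
Proof.
move=> s0 r0 hU; rewrite /diam_pow; case: ifPn => [_|/set0P[p Up]].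
  by rewrite lee_fin powR_ge0.
have d0 : (0 <= diam U)%E by apply: le_trans (le_diam Up Up); rewrite lee_fin edist_ge0.
by rewrite -poweR_EFin; apply: gt0_ler_poweR => //; rewrite in_itv /= ?leey ?andbT.
Qed.

Definition fdiam U : R := if U == set0 then 0 else fine (diam U).

Section SmallSet.
Variables (U : set (R * R)) (smallU : (diam U <= 1)%E).

Lemma fdiam_bounds : 0 <= fdiam U <= 1.
Proof.
rewrite /fdiam; case: ifPn => [_|/set0P[p Up]]; first by rewrite lexx ler01.
have d0 : (0 <= diam U)%E by apply: le_trans (le_diam Up Up); rewrite lee_fin edist_ge0.
have fd : diam U \is a fin_num by rewrite ge0_fin_numE // (le_lt_trans smallU) // ltry.
by rewrite fine_ge0 //= -lee_fin fineK.
Qed.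

Lemma edist_le_fdiam p q : U p -> U q -> edist p q <= fdiam U.
Proof.
move=> Up Uq; rewrite /fdiam ifF; last by apply/negP => /eqP h; rewrite h in Up.
have h := le_diam Up Uq.
have fd : diam U \is a fin_num.
  rewrite ge0_fin_numE ?(le_lt_trans smallU) ?ltry //.
  by apply: le_trans h; rewrite lee_fin edist_ge0.
by rewrite -lee_fin fineK.
Qed.

Lemma fdiam_pow s : 0 < s -> ((fdiam U `^ s)%:E <= diam_pow s U)%E.
Proof.
move=> s0; rewrite /fdiam /diam_pow; case: ifPn => [_|/set0P[p Up]].
  by rewrite powR0 // gt_eqF.
rewrite -poweR_EFin fineK // ge0_fin_numE ?(le_lt_trans smallU) ?ltry //.
by apply: le_trans (le_diam Up Up); rewrite lee_fin edist_ge0.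
Qed.

Lemma diam_pow_anti s t : 0 <= s -> s <= t -> (diam_pow t U <= diam_pow s U)%E.
Proof.
move=> s0 st; rewrite /diam_pow; case: ifPn => // /set0P[p Up].
have d0 : (0 <= diam U)%E by apply: le_trans (le_diam Up Up); rewrite lee_fin edist_ge0.
have fd : diam U \is a fin_num by rewrite ge0_fin_numE // (le_lt_trans smallU) // ltry.
have := smallU; rewrite -(fineK fd) !poweR_EFin !lee_fin => d1.
have {}d0 : 0 <= fine (diam U) by exact: fine_ge0.
move: d0; rewrite le_eqVlt => /predU1P[<-|d0]; last by apply: ger_powR => //; rewrite d0.
(* For diameter 0 the power with exponent t is 0 unless t = 0, and then s = 0 as well. *)
have [t0 | t0] := eqVneq t 0.
  by rewrite (_ : s = t) //; apply/le_anti; rewrite st t0 s0.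
by rewrite powR0 // powR_ge0.
Qed.

End SmallSet.
End Covers.

(** * Lower bound by counting extensions of words *)

Section Mass.
Context {R : realType} (K : set (R * R)) (levyK : is_levy_dragon K).
Variables (beta C : R) (beta1 : 1 < beta).
Hypothesis rate : forall n, beta ^+ n <= (growth n)%:R <= C * beta ^+ n.

Let N : R := (size (box 6))%:R.

(** Each graph word of the maximal length n has a boundary point in its cell, so it is charged to
    some V i. The prefixes of length k i charged to V i are at most N, and each has at most growth
    (n - k i) extensions. *)
Lemma mass (m : nat) (V : nat -> set (R * R)) (k : nat -> nat) :
  boundary K `<=` \bigcup_(i in [set i | (i < m)%N]) V i ->
  (forall i p q, (i < m)%N -> V i p -> V i q -> edist p q <= 3 * rho ^+ k i) ->
  1 <= N * C * \sum_(i < m) beta ^- k i.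
Proof.
move=> cov hV.
have b0 : 0 < beta by apply: lt_trans beta1.
pose n := (\max_(i < m) k i)%N.
have kn (i : 'I_m) : (k i <= n)%N by exact: leq_bigmax.
pose r (i : nat) (J : seq 'I_2) : bool :=
  `[< exists x w, [/\ V i x, K w & x = f_seq (take (k i) J) w] >].
have hcov J : J \in words_in graph_word n -> exists2 i, i \in iota 0 m & r i J.
  move=> /mem_words_in[sJ /(graph_word_boundary levyK)[x [w [bx Kw hx]]]].
  have [i im Vx] := cov x bx; exists i; first by rewrite mem_iota.
  apply/asboolP; exists x, (f_seq (drop (k i) J) w); split => //.
    exact: dragon_f_seq.
  by rewrite -f_seq_cat cat_take_drop.
have hsize (i : 'I_m) : (size [seq J <- words_in graph_word n | r i J] <=
    size (box 6) * growth (n - k i))%N.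
  pose P := [seq u <- words_in graph_word (k i) | r i u].
  apply: (@leq_trans (size [seq u ++ v | u <- P, v <- words_in graph_word (n - k i)])).
    apply: uniq_leq_size => [|J]; first exact/filter_uniq/words_in_uniq.
    rewrite mem_filter => /andP[rJ /mem_words_in[sJ gJ]].
    rewrite -(cat_take_drop (k i) J); move: gJ.
    rewrite -{1}(cat_take_drop (k i) J) => /graph_word_cat[g1 g2].
    apply: allpairs_f.
      rewrite mem_filter; apply/andP; split.
        by move: rJ; rewrite /r take_takel.
      by apply/mem_words_in; rewrite size_takel // sJ.
    by apply/mem_words_in; rewrite size_drop sJ.
  rewrite size_allpairs leq_mul2r; apply/orP; right.
  case hP : P => [//|I0 P']; rewrite -hP.
  have memP J : J \in P -> size J = k i /\ r i J.
    by rewrite mem_filter => /andP[? /mem_words_in[]].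
  have [sI0 /asboolP[x [w [Vx Kw hx]]]] : size I0 = k i /\ r i I0.
    by apply: memP; rewrite hP mem_head.
  (* In units of rho ^ k i, the centers are at distance at most 5 / 4 + 3 + 5 / 4 <= 6 - 1 / 4. *)
  apply: (@neighbors_bound 6 I0); first exact/filter_uniq/words_in_uniq.
  move=> J /memP[sJ /asboolP[y [v [Vy Kv hy]]]].
  have sIJ : size I0 = size J by rewrite sI0.
  split => //; apply: (@inbox_close R); first exact: run_unit.
  rewrite take_oversize ?sI0 // in hx; rewrite take_oversize ?sJ // in hy.
  have := hV i x y (ltn_ord i) Vx Vy.
  rewrite hx hy -(act1 v).
  have -> : f_seq J (act iso1 v) = f_seq I0 (act (run iso1 I0 J) v) by rewrite -act_f_seq // !act1.
  rewrite edist_f_seq sI0 mulrC ler_pM2r ?exprn_gt0 ?rho_gt0 // => h.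
  apply: le_trans (edist_triangle (act (run iso1 I0 J) v) _ _) _.
  rewrite edist_act ?run_unit // edistC.
  apply: le_trans (lerD (dragon_ball levyK Kv) (edist_triangle w _ _)) _.
  rewrite edistC; have := dragon_ball levyK Kw; lra.
have : beta ^+ n <= \sum_(i < m) N * (C * beta ^+ (n - k i)).
  have /andP[h _] := rate n; apply: le_trans h _.
  apply: (@le_trans _ _ (\sum_(i < m) (size (box 6) * growth (n - k i))%N%:R)).
    rewrite -natr_sum ler_nat; apply: leq_trans (size_cover hcov) _.
    rewrite -[X in iota 0 X]subn0 big_mkord; exact: leq_sum.
  apply: ler_sum => i _; rewrite natrM ler_wpM2l //.
  by have /andP[] := rate (n - k i).
have -> : \sum_(i < m) N * (C * beta ^+ (n - k i)) =
    beta ^+ n * (N * C * \sum_(i < m) beta ^- k i).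
  rewrite !mulr_sumr; apply: eq_bigr => i _.
  rewrite -{2}(subnK (kn i)) exprD; field.
  by rewrite expf_neq0 // gt_eqF.
by rewrite -[X in X <= _]mulr1 ler_pM2l // exprn_gt0.
Qed.

End Mass.

Lemma rho_level (R : realType) (r : R) : 0 < r -> r <= 1 ->
  exists k, rho ^+ k.+1 < r <= rho ^+ k.
Proof.
move=> r0 r1; have hex : exists n, rho ^+ n < r.
  by have [n hn] := @exists_rho_exp R 1 _ r0; exists n; rewrite mulr1 in hn.
case: (ex_minnP hex) => -[|k] hk hmin; first by rewrite expr0 ltNge r1 in hk.
exists k; rewrite hk leNgt; apply/negP => /hmin; by rewrite ltnn.
Qed.

Section HausdorffBounds.
Context {R : realType} (K : set (R * R)) (levyK : is_levy_dragon K).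
Variables (beta C alpha : R) (beta1 : 1 < beta) (C0 : 0 < C).
Hypothesis rate : forall n, beta ^+ n <= (growth n)%:R <= C * beta ^+ n.
Hypotheses (alpha0 : 0 < alpha) (rho_alpha : rho `^ alpha = beta^-1).

Lemma rho_exp_alpha n : (rho ^+ n) `^ alpha = beta ^- n.
Proof.
have r0 := ltW (@rho_gt0 R).
by rewrite -powR_mulrn // powRAC rho_alpha powR_mulrn ?exprVn // -rho_alpha powR_ge0.
Qed.

Lemma boundary_compact : compact (boundary K).
Proof.
have [_ cK _] := levyK; apply: subclosed_compact cK _.
  rewrite /boundary setDE; apply: closedI; first exact: closed_closure.
  exact/open_closedC/open_interior.
by move=> x [+ _]; rewrite -(closure_id K).1 //; exact: dragon_closed.
Qed.

(** The constant of [mass], a factor beta for rounding diameters to powers of rho, and a factor 2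
    for enlarging the covering sets to open ones. *)
Definition mass_bound : R := (2 * ((size (box 6))%:R * C * beta))^-1.

Lemma mass_bound_gt0 : 0 < mass_bound.
Proof. by rewrite invr_gt0 !mulr_gt0 // ?ltr0n // (lt_trans _ beta1). Qed.

Lemma mass_cover (U : nat -> set (R * R)) :
  boundary K `<=` \bigcup_i U i -> (forall i, (diam (U i) <= 1)%E) ->
  (mass_bound%:E <= \sum_(0 <= i <oo) diam_pow alpha (U i))%E.
Proof.
move=> cov small; have b0 : 0 < beta by apply: lt_trans beta1.
(* x i is the cost allowed for enlarging U i; the total stays below [mass_bound]. The radius r i is
   positive even if U i is a point. *)
pose x i : R := mass_bound / 2 ^+ i.+1.
pose eps i : R := Num.min 1 (x i `^ alpha^-1).
pose r i : R := Num.max (fdiam (U i)) (eps i).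
have x0 i : 0 < x i by rewrite divr_gt0 ?mass_bound_gt0 ?exprn_gt0.
have eps0 i : 0 < eps i by rewrite lt_min ltr01 powR_gt0.
have epsx i : eps i `^ alpha <= x i.
  have -> : x i = (x i `^ alpha^-1) `^ alpha.
    by rewrite -powRrM mulVf ?gt_eqF // powRr1 // ltW.
  apply: ge0_ler_powR; rewrite ?nnegrE ?powR_ge0 ?(ltW alpha0) ?(ltW (eps0 i)) //.
  by rewrite ge_min lexx orbT.
have r0 i : 0 < r i by rewrite lt_max eps0 orbT.
have r1 i : r i <= 1.
  by rewrite ge_max ge_min lexx /= andbT; have /andP[] := fdiam_bounds (small i).
have rx i : r i `^ alpha <= fdiam (U i) `^ alpha + x i.
  rewrite /r; case: (leP (fdiam (U i))) => _.
    by apply: (le_trans (epsx i)); rewrite lerDr powR_ge0.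
  by rewrite lerDl ltW.
have [k hk] := choice (fun i => rho_level (r0 i) (r1 i)).
pose V i : set (R * R) := [set p | exists2 q, U i q & edist q p < r i].
have openV i : open (V i).
  rewrite openE => p [q Uq hq]; apply/nbhs_edist; exists (r i - edist q p).
    by rewrite subr_gt0.
  move=> y hy; exists q => //; apply: le_lt_trans (edist_triangle p _ _) _.
  by rewrite -ltrBrDl.
(* Compactness, with the finite subcover taken as an initial segment of the indices. *)
have [m _ /(_ m (leqnn m)) covm] : \forall m \near \oo,
    boundary K `<=` \bigcup_(i in [set i | (i < m)%N]) V i.
  apply: (compact_near_coveringP _).1 boundary_compact _ \oo _ _ _ => p /cov[i _ Up].
  exists (V i, [set m | (i < m)%N]) => /=.
    split; last by exists i.+1.
    by apply: open_nbhs_nbhs; split => //; exists p; rewrite ?edist_xx.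
  by move=> [q m] /= [Vq im]; exists i.
have hV i p q : (i < m)%N -> V i p -> V i q -> edist p q <= 3 * rho ^+ k i.
  move=> _ [p' Up hp] [q' Uq hq].
  apply: le_trans (edist_triangle p' _ _) _.
  apply: le_trans (lerD (lexx _) (edist_triangle q' _ _)) _.
  have h := edist_le_fdiam (small i) Up Uq.
  have hd : fdiam (U i) <= r i by rewrite le_max lexx.
  have /andP[_ hr] := hk i; rewrite edistC; lra.
have hm := mass levyK beta1 rate covm hV.
apply: le_trans (nneseries_lim_ge m _); last by move=> *; exact: diam_pow_ge0.
apply: (@le_trans _ _ (\sum_(0 <= i < m) (fdiam (U i) `^ alpha)%:E)%E); last first.
  by apply: lee_sum => i _; apply: fdiam_pow.
rewrite sumEFin lee_fin.
have hx : \sum_(i < m) x i <= mass_bound.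
  suff -> : \sum_(i < m) x i = mass_bound * (1 - 2 ^- m).
    by rewrite ler_piMr ?(ltW mass_bound_gt0) // gerBl invr_ge0 exprn_ge0.
  elim: (m) => [|j IH]; first by rewrite big_ord0 expr0 invr1 subrr mulr0.
  rewrite big_ord_recr /= IH /x exprS; field.
  by rewrite expf_neq0.
have hk' i : beta ^- k i <= beta * (fdiam (U i) `^ alpha + x i).
  apply: le_trans (ler_wpM2l (ltW b0) (rx i)).
  rewrite -ler_pdivrMl // -invfM -exprS -rho_exp_alpha.
  have /andP[h _] := hk i.
  by apply: ge0_ler_powR;
    rewrite ?nnegrE ?exprn_ge0 ?(ltW (@rho_gt0 R)) ?(ltW alpha0) ?(ltW (r0 i)) ?(ltW h).
have : 2 * mass_bound <= \sum_(i < m) (fdiam (U i) `^ alpha + x i).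
  rewrite /mass_bound invfM mulrA divff // mul1r -[leLHS]mulr1 ler_pdivrMl; last first.
    by rewrite !mulr_gt0 // ltr0n.
  apply: le_trans hm _; rewrite -[leRHS]mulrA ler_pM2l ?mulr_gt0 ?ltr0n // mulr_sumr.
  by apply: ler_sum.
rewrite big_split /= big_mkord; lra.
Qed.

End HausdorffBounds.

Section HausdorffMeasure.
Context {R : realType} (K : set (R * R)) (levyK : is_levy_dragon K).
Variables (beta C alpha : R) (beta1 : 1 < beta) (C0 : 0 < C).
Hypothesis rate : forall n, beta ^+ n <= (growth n)%:R <= C * beta ^+ n.
Hypotheses (alpha0 : 0 < alpha) (rho_alpha : rho `^ alpha = beta^-1).

Lemma hausdorff_content_ge0 s d (E : set (R * R)) : (0 <= hausdorff_content s d E)%E.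
Proof.
apply/ereal_infP => _ [U _ <-]; apply: nneseries_ge0 => *; exact: diam_pow_ge0.
Qed.

(** For sets of diameter at most 1, lowering the exponent only increases the sums bounded in
    [mass_cover]. *)
Lemma hausdorff_measure_lower s : 0 <= s -> s <= alpha ->
  ((mass_bound beta C)%:E <= hausdorff_measure s (boundary K))%E.
Proof.
move=> s0 sa.
apply: (@le_trans _ _ (hausdorff_content s 1 (boundary K))); last first.
  by apply: ereal_sup_ubound; exists 1 => //=.
apply/ereal_infP => _ [U [cov small] <-].
apply: le_trans (mass_cover levyK beta1 C0 rate alpha0 rho_alpha cov small) _.
by apply: lee_nneseries => *; [exact: diam_pow_ge0 | exact: diam_pow_anti].
Qed.

Lemma hausdorff_content_upper s d n : 0 <= s -> rho ^+ n * 24 <= d ->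
  (hausdorff_content s d (boundary K) <= ((growth n)%:R * (24 * rho ^+ n) `^ s)%:E)%E.
Proof.
move=> s0 hd; have rn : 0 < rho ^+ n :> R by rewrite exprn_gt0 ?rho_gt0.
pose M : R := (24 * rho ^+ n) `^ s.
(* Disks of diameter 24 rho ^ n about the centers of the graph cells, continued by empty sets, which
   contribute 0. *)
pose U i : set (R * R) := if (i < growth n)%N then
  [set x | edist x (f_seq (nth [::] (words_in graph_word n) i) ctr) <= rho ^+ n * 12] else set0.
have hU i : (diam (U i) <= (24 * rho ^+ n)%:E)%E.
  apply: diam_le => p q; rewrite /U; case: ifP => // _ /= hp hq.
  apply: le_trans (edist_triangle (f_seq (nth [::] (words_in graph_word n) i) ctr) _ _) _.
  by rewrite (edistC _ q); lra.
apply: (@le_trans _ _ (\sum_(0 <= i <oo) diam_pow s (U i))%E).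
  apply: ereal_inf_lbound; exists U => //; split; last first.
    by move=> i; apply: le_trans (hU i) _; rewrite lee_fin mulrC.
  move=> x /(boundary_near_graph_word levyK n)[w [sw gw0 hx]].
  have hw : w \in words_in graph_word n by apply/mem_words_in.
  by exists (index w (words_in graph_word n)) => //; rewrite /U index_mem hw /= nth_index.
apply: lime_le; first by apply: is_cvg_nneseries => *; exact: diam_pow_ge0.
apply: nearW => m.
apply: (@le_trans _ _ ((minn m (growth n))%:R * M)%:E); last first.
  by rewrite lee_fin ler_wpM2r ?powR_ge0 // ler_nat geq_minr.
elim: m => [|m IH]; first by rewrite big_geq // min0n mul0r.
rewrite big_nat_recr //=; have [hm|hm] := ltnP m (growth n).
  rewrite (minn_idPl hm) -[m.+1]addn1 natrD mulrDl mul1r EFinD.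
  apply: leeD; first by rewrite (minn_idPl (ltnW hm)) in IH.
  by apply: diam_pow_le => //; rewrite mulr_ge0 // ltW.
rewrite {2}/U ltnNge hm /= /diam_pow eqxx adde0.
by rewrite (minn_idPr (leqW hm)) -(minn_idPr hm).
Qed.

Lemma powR_scale s n : (24 * rho ^+ n) `^ s = 24 `^ s * (rho `^ s) ^+ n :> R.
Proof.
have r0 := ltW (@rho_gt0 R).
rewrite powRM ?exprn_ge0 // -powR_mulrn // powRAC powR_mulrn //; exact: powR_ge0.
Qed.

Lemma hausdorff_measure_upper :
  (hausdorff_measure alpha (boundary K) <= (C * 24 `^ alpha)%:E)%E.
Proof.
apply: ge_ereal_sup => _ [d /= d0 <-].
have [n hn] := @exists_rho_exp R 24 _ d0.
apply: le_trans (hausdorff_content_upper (ltW alpha0) (ltW hn)) _.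
rewrite lee_fin powR_scale rho_alpha mulrCA mulrC ler_wpM2r ?powR_ge0 //.
have bn : 0 < beta ^+ n by rewrite exprn_gt0 // (lt_trans _ beta1).
by rewrite exprVn ler_pdivrMr //; have /andP[] := rate n.
Qed.

Lemma hausdorff_measure_eq0 s : alpha < s -> hausdorff_measure s (boundary K) = 0%E.
Proof.
move=> sa; have s0 : 0 <= s by rewrite ltW // (lt_trans alpha0).
have b0 : 0 < beta by apply: lt_trans beta1.
suff h d : 0 < d -> hausdorff_content s d (boundary K) = 0%E.
  apply/eqP; rewrite eq_le; apply/andP; split.
    by apply: ge_ereal_sup => _ [d /= d0 <-]; rewrite h.
  by rewrite -(h 1) //; apply: ereal_sup_ubound; exists 1 => //=.
move=> d0; apply/eqP; rewrite eq_le hausdorff_content_ge0 andbT.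
apply/lee_addgt0Pr => e e0; rewrite add0e.
pose q := beta * rho `^ s.
have q0 : 0 <= q by rewrite mulr_ge0 ?powR_ge0 // ltW.
have q1 : q < 1.
  rewrite /q mulrC -ltr_pdivlMr // div1r -rho_alpha.
  rewrite /powR gt_eqF ?rho_gt0 // ltr_expR ltr_nM2r // ln_lt0 // rho_gt0 /=.
  by have /andP[_] := @rho_bound R; lra.
have [n1 hn1] := @exists_rho_exp R 24 _ d0.
have hq : (fun n => C * 24 `^ s * q ^+ n) @ \oo --> C * 24 `^ s * 0.
  by apply: cvgM; [exact: cvg_cst | apply: cvg_expr; rewrite ger0_norm].
rewrite mulr0 in hq.
have /cvgr_lt /(_ _ e0) [n2 _ hn2] := hq.
pose n := maxn n1 n2.
have hd : rho ^+ n * 24 <= d.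
  apply: le_trans (ltW hn1); rewrite ler_wpM2r //.
  apply: ler_wiXn2l; rewrite ?leq_maxl ?(ltW (@rho_gt0 R)) //.
  by have /andP[_] := @rho_bound R; lra.
apply: le_trans (hausdorff_content_upper s0 hd) _.
rewrite lee_fin; apply: le_trans (ltW (hn2 n (leq_maxr _ _))).
rewrite powR_scale exprMn mulrA [leRHS]mulrA ler_wpM2r ?exprn_ge0 ?powR_ge0 //.
rewrite mulrAC ler_wpM2r ?powR_ge0 //.
by have /andP[] := rate n.
Qed.

Lemma hausdorff_dim_boundary : hausdorff_dim (boundary K) = alpha%:E.
Proof.
apply/eqP; rewrite eq_le; apply/andP; split.
  apply/lee_addgt0Pr => e e0; apply: ereal_inf_lbound; exists (alpha + e) => //=.
  by split; [rewrite addr_ge0 // ltW | rewrite hausdorff_measure_eq0 // ltrDl].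
apply/ereal_infP => _ [s [s0 hs] <-]; rewrite lee_fin leNgt; apply/negP => sa.
have := hausdorff_measure_lower s0 (ltW sa); rewrite hs lee_fin; apply/negP.
by rewrite -ltNge mass_bound_gt0.
Qed.

End HausdorffMeasure.

Theorem theorem4p5 (R : realType) (K : set (R * R)) (levyK : is_levy_dragon K) :
  exists beta : R,
    ((#|B R k|%:R : R) `^ k%:R^-1 @[k --> \oo] --> beta) /\
    let alpha := ln beta / ln (Num.sqrt 2) in
    hausdorff_dim (boundary K) = alpha%:E /\
    (0 < hausdorff_measure alpha (boundary K) < +oo)%E.
Proof.
have [beta [beta1 rate]] := growth_rate R.
have C0 : 0 < 2 ^+ mixing :> R by rewrite exprn_gt0.
exists beta; split; first exact: cvg_card_B beta1 C0 rate.
set alpha := ln beta / ln (Num.sqrt 2).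
have s1 : 1 < Num.sqrt 2 :> R by rewrite -[ltLHS]sqrtr1 ltr_sqrt // ltr1n.
have ls0 : 0 < ln (Num.sqrt 2) :> R by rewrite ln_gt0.
have alpha0 : 0 < alpha by rewrite divr_gt0 // ln_gt0.
have rho_alpha : rho `^ alpha = beta^-1.
  rewrite /powR gt_eqF ?rho_gt0 // /rho lnV ?posrE ?sqrtr_gt0 //.
  rewrite /alpha mulrN divfK ?gt_eqF // expRN lnK // posrE.
  exact: lt_trans beta1.
split; first exact: (hausdorff_dim_boundary levyK beta1 C0 rate alpha0 rho_alpha).
apply/andP; split.
  apply: lt_le_trans (hausdorff_measure_lower levyK beta1 C0 rate alpha0 rho_alpha
    (ltW alpha0) (lexx _)).
  by rewrite lte_fin mass_bound_gt0.
apply: le_lt_trans (hausdorff_measure_upper levyK beta1 rate alpha0 rho_alpha) _.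
exact: ltry.
Qed.
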